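(* If $0<p<\frac12$, then for the $p$-percentile rule $A_n/n^{1-p}$ converges almost surely as $n\to\infty$ to a nondegenerate random variable.
   Context: $X_1,X_2,\ldots$ are i.i.d. real random variables with a continuous distribution. Smaller values are better; $R_i^n=\sum_{j=1}^n I\{X_j\le X_i\}$ is the rank of $X_i$ among $X_1,\ldots,X_n$. For fixed $0<p\le1$ the $p$-percentile rule retains items as follows: $S_1=\{1\}$, and for $n\ge 2$, $X_n$ is retained (i.e. $S_n=S_{n-1}\cup\{n\}$) if and only if $R_n^n\le\lceil pL_{n-1}\rceil$, otherwise $S_n=S_{n-1}$; here $S_n$ is the set of indices of retained items among the first $n$ and $L_n=|S_n|$. $Q_n=\sum_{i\in S_n}R_i^n$ is the sum of the ranks of the retained items and $A_n=Q_n/L_n$ is their average rank. ''Nondegenerate'' means not almost surely equal to a constant. *)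

(* Defs.v *)
From HB Require Import structures.
From mathcomp Require Import all_boot all_order all_algebra finmap.
From mathcomp Require Import all_classical all_reals all_analysis.
Import Order.TTheory GRing.Theory Num.Theory.
Import numFieldNormedType.Exports.

Set Implicit Arguments.
Unset Strict Implicit.
Unset Printing Implicit Defensive.

Local Open Scope classical_set_scope.
Local Open Scope ring_scope.
Local Open Scope fset_scope.

(* Items are numbered from 0, so [x i] stands for X_(i+1), and the first
   [n] items are those of index [i < n]. *)
Section percentile_rule.
Context {R : realType}.
Implicit Types (p : R) (x : nat -> R) (n i : nat).

Definition rank x n i : nat := (\sum_(j < n) (x j <= x i)%R)%N.

(* The first item is always retained; the item [m] is the last of the first
   [m.+1] items, hence the rank [rank x m.+1 m]. *)
Fixpoint retained p x n : {fset nat} :=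
  if n is m.+1 then
    let S := retained p x m in
    if (m == 0%N) || ((rank x m.+1 m)%:Z <= Num.ceil (p * #|` S|%:R))
    then m |` S else S
  else fset0.

Definition num_retained p x n : nat := #|` retained p x n|.

Definition rank_sum p x n : nat := (\sum_(i <- retained p x n) rank x n i)%N.

Definition avg_rank p x n : R :=
  (rank_sum p x n)%:R / (num_retained p x n)%:R.

End percentile_rule.

Section random_variables.
Context d (T : measurableType d) {R : realType} (P : probability T R).

Definition mutually_independent (X : nat -> {RV P >-> R}) : Prop :=
  forall (I : {fset nat}) (B : nat -> set R),
    (forall i, measurable (B i)) ->
    P (\bigcap_(i in [set` I]) (X i @^-1` B i)) =
    (\prod_(i <- I) P (X i @^-1` B i))%E.

(* Restricted to measurable sets: [distribution] is a total function on sets,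
   whose values on nonmeasurable sets carry no meaning. *)
Definition identically_distributed (X : nat -> {RV P >-> R}) : Prop :=
  forall i j (B : set R), measurable B ->
    distribution P (X i) B = distribution P (X j) B.

Definition continuous_distribution (X : {RV P >-> R}) : Prop :=
  continuous (cdf X).

Definition nondegenerate_rv (Y : {RV P >-> R}) : Prop :=
  ~ exists c : R, {ae P, forall w, Y w = c}.

End random_variables.

(* Main.v *)
(* The relative ranks of successive items are independent and uniform, so the
   number L_n of retained items is a Markov chain: with k = ceil(p L_n), item
   n+1 is retained with probability k/(n+1).  Let a_n = prod_(2 <= j <= n)
   (1 + p/j), which is asymptotic to a constant times n^p.  Then L_n / a_n and
   Q_n / (n+1) are submartingales, and their drifts and conditional variances
   are bounded in expectation by telescoping differences of 1 / a_n and of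
   b_n / (n+1), b_n = prod (1 + 2p/j); the latter tends to 0 exactly because
   p < 1/2.  Along n = (k+1)^m with m large the L1 increments are summable, so
   both processes converge almost surely along this subsequence, and by
   monotonicity of L_n and Q_n along the whole sequence.  The limit of
   L_n / a_n is positive because E(a_n / L_n) is bounded.  Finally, exchanging
   the relative ranks 2 and 3 of the third item leaves the law of (L_n)
   unchanged but shifts E(Q_n / (n+1)) by a nonzero constant, so the limits of
   Q_n / n and L_n / n^p are not proportional. *)
Require Import Defs.
From mathcomp Require Import all_boot all_order all_fingroup all_algebra finmap.
From mathcomp Require Import all_classical all_reals all_analysis.
From mathcomp Require Import measurable_realfun zify ring lra.
Import Order.TTheory GRing.Theory Num.Theory.
Import numFieldNormedType.Exports.

Set Implicit Arguments.
Unset Strict Implicit.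
Unset Printing Implicit Defensive.

Local Open Scope classical_set_scope.
Local Open Scope ring_scope.

(** * Averages over the order patterns of the first n items *)

(** Everything in play depends only on the order of the items, so expectations are finite means
    [avg] over permutations, linked to integrals by [integral_order_inv]. Conditioning on the first
    [n] items becomes testing against weights [G] with [order_inv n G]. Such weights give both the
    orthogonality of martingale increments and, with [contrast], nondegeneracy. No martingale
    convergence theorem is invoked: the distance between times [n] and [m] is bounded in L1 by
    [t + s n / t + s n]. With [t = k^-2] this is summable once [s] is of order [k^-4] along
    [n = k^m], whence the requirements [4 <= m p] and [4 <= m (1 - 2p)]. The ceiling spoils exact
    proportionality: the quota lies between [p L] and [p L + 1], which creates a drift. Shifting [L]
    by [1/p] absorbs it in the moment bounds. The law of the limiting quotient is out of reach, but
    a constant quotient would be a linear relation between the limits of [Q_n / n] and [L_n / n^p],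
    and L1 convergence carries such a relation back to means at finite times. *)

Lemma sum_ltn_ord m r : (r <= m)%N -> (\sum_(a < m) (a < r)%N = r)%N.
Proof.
move=> rm; rewrite -(big_mkord xpredT (fun b => nat_of_bool (b < r)%N)) /=.
rewrite (big_cat_nat (n := r)) //=.
rewrite (eq_big_nat _ _ (F2 := fun=> 1%N)) => [|i /andP[_ ->]]//.
rewrite sum_nat_const_nat subn0 muln1 big_nat_cond big1 ?addn0//.
by move=> i /andP[/andP[ai _] _]; rewrite ltnNge ai.
Qed.

Section order_patterns.
Context {R : realType}.
Implicit Types (x y : nat -> R) (n : nat).

Definition same_order n x y :=
  forall i j, (i < n)%N -> (j < n)%N -> (x i <= x j) = (y i <= y j).

Definition order_inv {V : Type} n (g : (nat -> R) -> V) :=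
  forall x y, same_order n x y -> g x = g y.

Definition untied n x :=
  forall i j, (i < n)%N -> (j < n)%N -> x i = x j -> i = j.

(** A permutation read as a sample. The default 0 past index [n] is invisible to functions
    satisfying [order_inv n]. *)
Definition pattern n (s : 'S_n) : nat -> R :=
  fun i => oapp (fun j : 'I_n => (s j)%:R) 0 (insub i).

(* The expectation of [g] when the first [n] items come in uniformly random
   order. *)
Definition avg n (g : (nat -> R) -> R) : R :=
  (n`!%:R)^-1 * \sum_(s : 'S_n) g (pattern s).

Lemma patternE n (s : 'S_n) (i : 'I_n) : pattern s i = (s i)%:R.
Proof. by rewrite /pattern valK. Qed.

Lemma pattern_untied n (s : 'S_n) : untied n (pattern s).
Proof.
move=> i j ip jp; rewrite (patternE s (Ordinal ip)) (patternE s (Ordinal jp)).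
by move=> /eqP; rewrite eqr_nat => /eqP/val_inj/perm_inj [].
Qed.

Lemma eq_avg n g h : (forall x, untied n x -> g x = h x) -> avg n g = avg n h.
Proof.
by move=> gh; congr (_ * _); apply: eq_bigr => s _; exact/gh/pattern_untied.
Qed.

Lemma le_avg n g h : (forall x, untied n x -> g x <= h x) ->
  avg n g <= avg n h.
Proof.
move=> gh; rewrite ler_wpM2l ?invr_ge0//.
by apply: ler_sum => s _; exact/gh/pattern_untied.
Qed.

Lemma avgD n g h : avg n (fun x => g x + h x) = avg n g + avg n h.
Proof. by rewrite /avg big_split mulrDr. Qed.

Lemma avgZ n c g : avg n (fun x => c * g x) = c * avg n g.
Proof. by rewrite /avg -mulr_sumr mulrCA. Qed.

Lemma avgN n g : avg n (fun x => - g x) = - avg n g.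
Proof. by rewrite /avg sumrN mulrN. Qed.

Lemma avgB n g h : avg n (fun x => g x - h x) = avg n g - avg n h.
Proof. by rewrite avgD avgN. Qed.

Lemma avg_cst n c : avg n (fun=> c) = c.
Proof.
rewrite /avg sumr_const card_Sn -[c *+ _]mulr_natl mulrA mulVf ?mul1r//.
Qed.

Lemma order_inv_widen {V : Type} n m (g : (nat -> R) -> V) :
  (n <= m)%N -> order_inv n g -> order_inv m g.
Proof.
move=> nm gn x y xy; apply: gn => i j ip jp.
by apply: xy; exact: leq_trans nm.
Qed.

Lemma rank_le x n i : (rank x n i <= n)%N.
Proof.
rewrite -[leqRHS]card_ord -sum1_card; apply: leq_sum => j _; exact: leq_b1.
Qed.

Lemma rank_order_inv n i : (i < n)%N -> order_inv n (fun x => rank x n i).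
Proof. by move=> ip x y xy; apply: eq_bigr => j _; rewrite xy. Qed.

Lemma retained_order_inv p n : order_inv n (fun x => retained p x n).
Proof.
elim: n => // n IH x y xy /=.
rewrite (IH x y) => [|i j ip jp]; last by rewrite xy// ltnS ltnW.
by rewrite (rank_order_inv (ltnSn n) xy).
Qed.

Lemma retained_lt p x n i : i \in retained p x n -> (i < n)%N.
Proof.
elim: n => [|n IH] //=; case: ifP => _; last by move/IH/ltnW.
by rewrite in_fset1U => /predU1P[->|/IH/ltnW].
Qed.

Lemma num_retained_order_inv p n : order_inv n (fun x => num_retained p x n).
Proof. by move=> x y /(retained_order_inv p); rewrite /num_retained => ->. Qed.

Lemma rank_sum_order_inv p n : order_inv n (fun x => rank_sum p x n).
Proof.
move=> x y xy; rewrite /rank_sum (retained_order_inv p xy).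
by apply: eq_big_seq => i /retained_lt ip; exact: rank_order_inv.
Qed.

Lemma rank_pattern_lift n (a : 'I_n.+1) (s : 'S_n) :
  rank (pattern (lift_perm ord_max a s)) n.+1 n = a.+1.
Proof.
rewrite /rank big_ord_recr /= lexx addn1; congr _.+1.
have En : pattern (lift_perm ord_max a s) n = a%:R.
  by rewrite (patternE _ ord_max) lift_perm_id.
rewrite En; transitivity (\sum_(b < n) (b < a))%N.
  rewrite [RHS](reindex_inj (@perm_inj _ s)); apply: eq_bigr => i _ /=.
  have -> : nat_of_ord i = lift ord_max i :> nat.
    by rewrite /= /bump leqNgt ltn_ord.
  rewrite patternE lift_perm_lift ler_nat /= /bump; congr nat_of_bool.
  by case: leqP; lia.
by rewrite sum_ltn_ord// -ltnS.
Qed.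

Lemma pattern_lift_same_order n (a : 'I_n.+1) (s : 'S_n) :
  same_order n (pattern (lift_perm ord_max a s)) (pattern s).
Proof.
have E i (ip : (i < n)%N) :
    pattern (lift_perm ord_max a s) i = (lift a (s (Ordinal ip)))%:R.
  have {1}-> : i = lift ord_max (Ordinal ip) :> nat.
    by rewrite /= /bump leqNgt ip.
  by rewrite patternE lift_perm_lift.
move=> i j ip jp; rewrite !E (patternE s (Ordinal ip)) (patternE s (Ordinal jp)).
by rewrite !ler_nat /= leq_bump2.
Qed.

(** [lift_perm] splits a permutation of n+1 items bijectively into the value [a] of the last item
    and the order of the others. This is the uniformity of the last rank and its independence of the
    past. *)
Lemma avg_step n (H : (nat -> R) -> nat -> R) :
  (forall a, order_inv n (H^~ a)) ->
  avg n.+1 (fun x => H x (rank x n.+1 n)) =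
  avg n (fun x => n.+1%:R^-1 * \sum_(a < n.+1) H x a.+1).
Proof.
move=> Hn; pose f (u : 'I_n.+1 * 'S_n) := lift_perm ord_max u.1 u.2.
have f_inj : injective f.
  move=> [a s] [b t] /= /permP E.
  have ab : a = b by move: (E ord_max); rewrite !lift_perm_id.
  rewrite -ab in E *; congr pair; apply/permP => i.
  by move: (E (lift ord_max i)); rewrite !lift_perm_lift => /lift_inj.
have f_bij : bijective f.
  apply: inj_card_bij => //.
  by rewrite card_prod card_ord !card_Sn factS.
rewrite /avg (reindex f) /=; last exact: onW_bij.
rewrite -(pair_bigA _ (fun a s =>
  H (pattern (f (a, s))) (rank (pattern (f (a, s))) n.+1 n))) /=.
rewrite -mulr_sumr mulrA factS natrM invfM [_^-1 * _^-1]mulrC; congr (_ * _).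
rewrite exchange_big; apply: eq_bigr => s _; apply: eq_bigr => a _ /=.
by rewrite rank_pattern_lift; apply: Hn; exact: pattern_lift_same_order.
Qed.

End order_patterns.

(** * One step of the percentile rule *)

Lemma bin2_double k : ('C(k.+1, 2) * 2 = k * k.+1)%N.
Proof. by rewrite mulnC -mul_bin_diag bin1 mulnC. Qed.

Section percentile_step.
Context {R : realType}.
Variable p : R.
Hypotheses (p_gt0 : 0 < p) (p_lt_half : p < 2^-1).
Implicit Types (x : nat -> R) (n : nat).

Definition quota x n : nat := `|Num.ceil (p * (num_retained p x n)%:R)|%N.

(** These are the retained items that a newcomer of rank [r] pushes up by one; their ranks are those
    before its arrival. *)
Definition num_outranked x n r : nat :=
  \sum_(i <- retained p x n) (r <= rank x n i)%N.

Let L x n := num_retained p x n.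
Let Q x n := rank_sum p x n.

Let le_quota x n r :
  (r%:Z <= Num.ceil (p * (#|` retained p x n|)%:R)) = (r <= quota x n)%N.
Proof.
have c0 : 0 <= Num.ceil (p * (#|` retained p x n|)%:R).
  by rewrite ceil_ge0 (lt_le_trans (ltrN10 _))// mulr_ge0// ltW.
by rewrite -lez_nat /quota/num_retained gez0_abs.
Qed.

Lemma retainedS x n : (0 < n)%N -> retained p x n.+1 =
  if (rank x n.+1 n <= quota x n)%N then (n |` retained p x n)%fset
  else retained p x n.
Proof. by move=> n0; rewrite /= le_quota -[n == 0%N]negbK -lt0n n0. Qed.

Lemma num_retainedS x n : (0 < n)%N -> num_retained p x n.+1 =
  (num_retained p x n + (rank x n.+1 n <= quota x n))%N.
Proof.
move=> n0; rewrite /num_retained retainedS//; case: ifP; rewrite ?addn0// => _.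
by rewrite cardfsU1 addnC; case: (boolP (n \in _)) => // /retained_lt; rewrite ltnn.
Qed.

Lemma num_retained1 x : num_retained p x 1 = 1%N.
Proof. by rewrite /num_retained /= fsetU0 cardfs1. Qed.

Lemma num_retained_gt0 x n : (0 < n)%N -> (0 < num_retained p x n)%N.
Proof.
case: n => // n _; elim: n => [|n IH]; first by rewrite num_retained1.
by rewrite num_retainedS// addn_gt0 IH.
Qed.

Lemma num_retained_le x n : (num_retained p x n <= n)%N.
Proof.
case: n => // n; elim: n => [|n IH]; first by rewrite num_retained1.
by rewrite num_retainedS// -[leqRHS]addn1 leq_add// leq_b1.
Qed.

Lemma quota_ge x n : p * (num_retained p x n)%:R <= (quota x n)%:R.
Proof.
have c0 : 0 <= Num.ceil (p * (num_retained p x n)%:R).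
  by rewrite ceil_ge0 (lt_le_trans (ltrN10 _))// mulr_ge0// ltW.
rewrite /quota natr_absz ger0_norm//; exact: ceil_ge.
Qed.

Lemma quota_le x n : (quota x n)%:R <= p * (num_retained p x n)%:R + 1.
Proof.
have c0 : 0 <= Num.ceil (p * (num_retained p x n)%:R).
  by rewrite ceil_ge0 (lt_le_trans (ltrN10 _))// mulr_ge0// ltW.
rewrite /quota natr_absz ger0_norm// -lerBlDr.
by have := ceilB1_lt (p * (num_retained p x n)%:R); rewrite intrB => /ltW.
Qed.

Lemma quota_gt0 x n : (0 < n)%N -> (0 < quota x n)%N.
Proof.
move=> /(num_retained_gt0 x) L0; rewrite -(ltr_nat R).
by apply: lt_le_trans (quota_ge x n); rewrite mulr_gt0// ltr0n.
Qed.

Lemma quota_le_num x n : (quota x n <= num_retained p x n)%N.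
Proof.
have c0 : 0 <= Num.ceil (p * (num_retained p x n)%:R).
  by rewrite ceil_ge0 (lt_le_trans (ltrN10 _))// mulr_ge0// ltW.
rewrite -lez_nat /quota gez0_abs// ceil_le_int.
have -> : ((num_retained p x n)%:Z)%:~R = (num_retained p x n)%:R :> R by [].
rewrite -[leRHS]mul1r ler_wpM2r//; have := p_lt_half; lra.
Qed.

Lemma quota_ltn x n : (quota x n < n.+1)%N.
Proof. by rewrite ltnS (leq_trans (quota_le_num x n))// num_retained_le. Qed.

Lemma quota_order_inv n : order_inv n (fun x => quota x n).
Proof. by move=> x y xy; rewrite /quota (num_retained_order_inv p xy). Qed.

Lemma num_outranked_order_inv n r : order_inv n (fun x => num_outranked x n r).
Proof.
move=> x y xy; rewrite /num_outranked (retained_order_inv p xy).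
by apply: eq_big_seq => i /retained_lt ip; rewrite (rank_order_inv ip xy).
Qed.

Lemma num_outranked_le x n r : (num_outranked x n r <= num_retained p x n)%N.
Proof.
rewrite /num_outranked /num_retained cardfE -sum1_card big_seq_fsetE /=.
by apply: leq_sum => i _; exact: leq_b1.
Qed.

(** The newcomer counts itself, and when [x n < x i] item [i] compensates for that unit. With a tie
    the newcomer's rank would exceed the old rank of [i] by one, so untiedness matters. *)
Lemma rank_last_le x n i : (i < n)%N -> untied n.+1 x ->
  (x n <= x i) = (rank x n.+1 n <= rank x n i)%N.
Proof.
move=> ip ux; rewrite /rank big_ord_recr /= lexx addn1.
have [xni|xin] := leP (x n) (x i).
  apply/esym; rewrite [leqRHS](bigD1 (Ordinal ip))//= lexx add1n ltnS.
  rewrite [leqLHS](bigD1 (Ordinal ip))//=.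
  have -> : (x i <= x n) = false.
    apply/negbTE; rewrite -ltNge lt_neqAle xni andbT.
    apply/eqP => /ux -/(_ (ltnSn n) (ltnW ip)) ni.
    by move: ip; rewrite -ni ltnn.
  rewrite add0n; apply: leq_sum => j _.
  by case: (leP (x j)) => // /le_trans /(_ xni) ->.
apply/esym/negbTE; rewrite -ltnNge ltnS; apply: leq_sum => j _.
by case: (leP (x j)) => // /le_trans /(_ (ltW xin)) ->.
Qed.

Lemma rankS x n i : rank x n.+1 i = (rank x n i + (x n <= x i)%R)%N.
Proof. by rewrite /rank big_ord_recr. Qed.

Lemma rank_sumS x n : (0 < n)%N -> untied n.+1 x -> rank_sum p x n.+1 =
  (rank_sum p x n + num_outranked x n (rank x n.+1 n) +
   (rank x n.+1 n <= quota x n) * rank x n.+1 n)%N.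
Proof.
move=> n0 ux; have E : (\sum_(i <- retained p x n) rank x n.+1 i =
    rank_sum p x n + num_outranked x n (rank x n.+1 n))%N.
  rewrite -big_split; apply: eq_big_seq => i /retained_lt ip.
  by rewrite rankS rank_last_le.
rewrite -E /rank_sum retainedS//; case: ifP; rewrite ?addn0// => _.
rewrite big_fsetU1 ?mul1n; first by rewrite addnC.
by apply/negP => /retained_lt; rewrite ltnn.
Qed.

(** Double counting: a retained item of rank [r] is pushed up by exactly [r] of the n+1 possible
    ranks of the newcomer. *)
Lemma sum_num_outranked x n :
  (\sum_(a < n.+1) num_outranked x n a.+1 = rank_sum p x n)%N.
Proof.
rewrite /num_outranked exchange_big /=; apply: eq_bigr => i _.
by rewrite sum_ltn_ord// (leq_trans (rank_le x n i)).
Qed.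

(** Letting [F] depend on the first [n] items as well makes the identity usable for weighted means
    and for squared increments. *)
Lemma avg_num_retained_step n (F : (nat -> R) -> nat -> R) : (0 < n)%N ->
  (forall l, order_inv n (F^~ l)) ->
  avg n.+1 (fun x => F x (num_retained p x n.+1)) =
  avg n (fun x => F x (L x n) +
    (quota x n)%:R / n.+1%:R * (F x (L x n).+1 - F x (L x n))).
Proof.
move=> n0 FI.
pose H x r := F x (L x n + (r <= quota x n))%N.
transitivity (avg n.+1 (fun x => H x (rank x n.+1 n))).
  by apply: eq_avg => x _; rewrite num_retainedS.
rewrite avg_step {}/H => [|a x y xy]; last first.
  by rewrite /L (num_retained_order_inv p xy) (quota_order_inv xy); exact: FI.
apply: eq_avg => x _.
transitivity (n.+1%:R^-1 * \sum_(a < n.+1) (F x (L x n) +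
    (a < quota x n)%N%:R * (F x (L x n).+1 - F x (L x n)))).
  congr (_ * _); apply: eq_bigr => a _; case: leqP => _ /=.
    by rewrite addn0 mul0r addr0.
  by rewrite addn1 mul1r addrC subrK.
rewrite big_split /= -mulr_suml -natr_sum sum_ltn_ord; last exact/ltnW/quota_ltn.
rewrite sumr_const card_ord -[F x _ *+ _]mulr_natl.
have : n.+1%:R != 0 :> R by rewrite pnatr_eq0.
by move: (n.+1%:R : R) => N N0; field.
Qed.

(** The factor [(n+2)/(n+1)] dictates the normalization [Q / (n+1)]: after division by n+2 only the
    quota term is left as drift. *)
Lemma avg_rank_sum_step n (G : (nat -> R) -> R) : (0 < n)%N ->
  order_inv n G ->
  avg n.+1 (fun x => G x * (rank_sum p x n.+1)%:R) =
  avg n (fun x => G x * ((Q x n)%:R * (n.+2%:R / n.+1%:R) +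
    (quota x n)%:R * (quota x n).+1%:R / (2 * n.+1%:R))).
Proof.
move=> n0 GI.
pose H x r :=
  G x * (Q x n + num_outranked x n r + (r <= quota x n) * r)%N%:R.
transitivity (avg n.+1 (fun x => H x (rank x n.+1 n))).
  by apply: eq_avg => x ux; rewrite rank_sumS.
rewrite avg_step {}/H => [|a x y xy]; last first.
  rewrite /Q (rank_sum_order_inv p xy) (quota_order_inv xy).
  by rewrite (num_outranked_order_inv _ xy) (GI _ _ xy).
apply: eq_avg => x _.
rewrite -mulr_sumr -natr_sum !big_split /= sum_num_outranked.
rewrite sum_nat_const card_ord.
(* The newcomer adds its own rank only for ranks 1 to [quota], all of them possible by [quota_ltn]:
   a full triangular number. *)
have -> : (\sum_(a < n.+1) (a < quota x n) * a.+1 =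
    \sum_(0 <= a < (quota x n).+1) a)%N.
  rewrite big_nat_recl// add0n.
  rewrite -(big_mkord xpredT (fun a => (a < quota x n) * a.+1)%N).
  rewrite (big_cat_nat (n := quota x n)) //=; last exact/ltnW/quota_ltn.
  rewrite [X in (_ + X)%N]big_nat_cond [X in (_ + X)%N]big1 ?addn0; last first.
    by move=> i /andP[/andP[ai _] _]; rewrite ltnNge ai.
  by apply: eq_big_nat => i /andP[_ ->]; rewrite mul1n.
rewrite -natrM -bin2_double [(_ * 2)%:R]natrM.
rewrite -bin2_sum -/(Q x n) !natrD natrM -[n.+2%:R]natr1 -[n.+1%:R]natr1.
have : n%:R + 1 != 0 :> R by rewrite natr1 pnatr_eq0.
by move: (n%:R : R) ((\sum_(0 <= a < _) a)%N%:R : R) => N C N0; field.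
Qed.

End percentile_step.

(** * Moment estimates *)

Section growth_factors.
Context {R : realType}.
Implicit Types (c : R) (n : nat).

Definition growth c n : R := \prod_(1 <= j < n) (1 + c / j.+1%:R).

Lemma growth1 c : growth c 1 = 1.
Proof. by rewrite /growth big_geq. Qed.

Lemma growthS c n : (0 < n)%N ->
  growth c n.+1 = growth c n * (1 + c / n.+1%:R).
Proof. by move=> n0; rewrite /growth big_nat_recr. Qed.

Lemma growth_gt0 c n : -1 <= c -> 0 < growth c n.
Proof.
move=> c1; rewrite /growth big_nat_cond; apply: prodr_gt0 => j /andP[/andP[j0 _] _].
rewrite -ltrBlDl sub0r; apply: (@lt_le_trans _ _ (- j.+1%:R^-1)).
  by rewrite ltrN2 invf_lt1// ltr1n.
by rewrite -mulN1r ler_wpM2r// invr_ge0.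
Qed.

Lemma growth_homo c n m : 0 <= c -> (n <= m)%N -> growth c n <= growth c m.
Proof.
move=> c0 /subnKC <-; elim: (m - n)%N => [|k IH]; first by rewrite addn0.
rewrite addnS (le_trans IH)//.
have [nk|] := posnP (n + k)%N; first by rewrite nk /growth !big_geq.
move=> nk; rewrite growthS// ler_peMr ?lerDl ?divr_ge0//.
by rewrite ltW// growth_gt0// (le_trans _ c0)// lerN10.
Qed.

(** Factor by factor, [(1 - u) (1 + u) = 1 - u^2 <= 1]. *)
Lemma growthN_le c n : 0 <= c <= 1 -> growth (- c) n <= (growth c n)^-1.
Proof.
move=> /andP[c0 c1].
have a0 m : 0 < growth c m by rewrite growth_gt0// (le_trans _ c0)// lerN10.
have b0 m : 0 < growth (- c) m by rewrite growth_gt0// lerN2.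
rewrite -[leRHS]mul1r ler_pdivlMr// /growth -big_split /=.
rewrite big_nat_cond; apply: prodr_ile1 => j /andP[/andP[j0 _] _].
rewrite mulNr -subr_sqr expr1n subr_ge0 gerBl sqr_ge0 andbT.
by rewrite expr_le1// ?divr_ge0// ler_pdivrMr ?ltr0n// mul1r (le_trans c1)// ler1n.
Qed.

Lemma inv_growth_step c n : 0 <= c -> (0 < n)%N ->
  (growth c n)^-1 - (growth c n.+1)^-1 = c / (n.+1%:R * growth c n.+1).
Proof.
move=> c0 n0; rewrite growthS//.
have : growth c n != 0 by rewrite gt_eqF// growth_gt0// (le_trans _ c0)// lerN10.
have N0 : (0 : R) < n.+1%:R by rewrite ltr0n.
have : 1 + c / n.+1%:R != 0 by rewrite gt_eqF// ltr_wpDr// divr_ge0// ltW.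
move: (n.+1%:R : R) (growth c n) N0 => N a N0 cN a0.
have -> : 1 + c / N = (N + c) / N by field; rewrite gt_eqF.
have Nc : N + c != 0 by rewrite gt_eqF// ltr_wpDr.
by field; rewrite Nc a0 gt_eqF.
Qed.

Lemma growth_div_step c n : (0 < n)%N ->
  growth c n / n.+1%:R - growth c n.+1 / n.+2%:R =
  (1 - c) * growth c n / (n.+1%:R * n.+2%:R).
Proof.
move=> n0; rewrite growthS// -[n.+2%:R]natr1.
have N0 : (0 : R) < n.+1%:R by rewrite ltr0n.
move: (n.+1%:R : R) N0 => N N0.
have N1 : N + 1 != 0 by rewrite gt_eqF// ltr_wpDr.
by field; rewrite N1 gt_eqF.
Qed.

(** Young's inequality for the product of [u^c] and 1, with exponents [1/c] and [1/(1-c)]; the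
    endpoints, where an exponent degenerates, are treated apart. *)
Lemma bernoulli_powR c (u : R) : 0 <= c <= 1 -> 0 <= u ->
  u `^ c <= 1 + c * (u - 1).
Proof.
move=> /andP[c0 c1] u0.
have [->|cn0] := eqVneq c 0; first by rewrite powRr0 mul0r addr0.
have [->|cn1] := eqVneq c 1; first by rewrite powRr1// mul1r addrC subrK.
have cp : 0 < c by rewrite lt_neqAle eq_sym cn0.
have cq : 0 < 1 - c by rewrite subr_gt0 lt_neqAle cn1.
have := @conjugate_powR R (u `^ c) 1 c^-1 (1 - c)^-1 (powR_ge0 _ _) ler01.
rewrite !invr_gt0 cp cq !invrK addrC subrK => /(_ isT isT erefl).
rewrite mulr1 -powRrM mulfV// powRr1// powR1 mul1r => /le_trans; apply.
lra.
Qed.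

(** Bernoulli at [u = n/(n+1)] gives [u^c <= 1 - c/(n+1)], whose product with the new factor
    [1 + c/(n+1)] is at most 1. *)
Lemma growth_powR_nonincreasing c n : 0 <= c <= 1 -> (0 < n)%N ->
  growth c n.+1 / n.+1%:R `^ c <= growth c n / n%:R `^ c.
Proof.
move=> c01 n0; have /andP[c0 c1] := c01.
have N0 : (0 : R) < n%:R by rewrite ltr0n.
have N10 : (0 : R) < n.+1%:R by rewrite ltr0n.
rewrite ler_pdivrMr ?powR_gt0// growthS// -mulrA.
have g0 : 0 <= growth c n by rewrite ltW// growth_gt0// (le_trans _ c0)// lerN10.
rewrite ler_wpM2l//.
have := @bernoulli_powR c (n%:R / n.+1%:R) c01.
rewrite divr_ge0// => /(_ isT).
have -> : (n%:R / n.+1%:R : R) `^ c = n%:R `^ c / n.+1%:R `^ c.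
  rewrite powRM ?invr_ge0//; congr (_ * _).
  by rewrite -powR_inv1// -powRrM mulrC powRrM powR_inv1 ?powR_ge0.
have PN := powR_gt0 c N0; have PN1 := powR_gt0 c N10.
move: (n%:R `^ c) (n.+1%:R `^ c) PN PN1 => A B A0 B0 AB.
have {AB} : A / B * (1 + c / n.+1%:R) <= 1.
  have E : n%:R / n.+1%:R - 1 = - n.+1%:R^-1 :> R.
    by rewrite -natr1; field; rewrite natr1 gt_eqF.
  rewrite E in AB; set v := n.+1%:R^-1 in AB *.
  have v0 : 0 <= c * v by rewrite mulr_ge0// invr_ge0 ltW.
  apply: (@le_trans _ _ ((1 + c * - v) * (1 + c * v))).
    by rewrite ler_wpM2r// addr_ge0.
  by rewrite mulrN; nra.
rewrite mulrAC ler_pdivrMr// mul1r => AB.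
by rewrite ler_pdivlMl.
Qed.

(** Bernoulli at the ratio [(n+2)/(n+1)], starting from equality at [n = 1], which is where [2^c]
    comes from. This keeps the limit of [growth c n / n^c] away from 0. *)
Lemma growth_ge_powR c n : 0 <= c <= 1 -> (0 < n)%N ->
  n.+1%:R `^ c <= growth c n * 2 `^ c.
Proof.
move=> c01; have /andP[c0 c1] := c01.
case: n => // n _; elim: n => [|n IH]; first by rewrite growth1 mul1r.
rewrite growthS// mulrAC.
have g0 : 0 <= 1 + c / n.+2%:R by rewrite addr_ge0// divr_ge0.
apply: le_trans (ler_wpM2r g0 IH).
have N0 : (0 : R) < n.+2%:R by rewrite ltr0n.
have -> : n.+3%:R = n.+2%:R * (n.+3%:R / n.+2%:R) :> R.
  by rewrite mulrC divfK ?gt_eqF.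
rewrite powRM ?divr_ge0// ler_wpM2l ?powR_ge0//.
have := @bernoulli_powR c (n.+3%:R / n.+2%:R) c01.
rewrite divr_ge0// => /(_ isT)/le_trans; apply.
suff -> : n.+3%:R / n.+2%:R - 1 = n.+2%:R^-1 :> R by [].
by rewrite -[n.+3%:R]natr1; field; rewrite gt_eqF.
Qed.

Lemma growth_powR_cvg c : 0 <= c <= 1 ->
  exists2 k : R, 0 < k & growth c n / n%:R `^ c @[n --> \oo] --> k.
Proof.
move=> c01; have /andP[c0 c1] := c01.
pose u n := growth c n.+1 / n.+1%:R `^ c.
have u_ge n : (2 `^ c)^-1 <= u n.
  rewrite /u ler_pdivlMr ?powR_gt0// ler_pdivrMl ?powR_gt0// mulrC.
  apply: le_trans (growth_ge_powR c01 (ltn0Sn n)).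
  by rewrite ge0_ler_powR// ?nnegrE// ler_nat.
have u_dec : nonincreasing_seq u.
  by apply/nonincreasing_seqP => n; exact: growth_powR_nonincreasing.
have u_cvg : cvgn u.
  apply: nonincreasing_is_cvgn => //; exists (2 `^ c)^-1.
  by move=> _ [n _ <-].
exists (limn u).
  apply: (@lt_le_trans _ _ (2 `^ c)^-1); first by rewrite invr_gt0 powR_gt0.
  by apply: limr_ge => //; exact: nearW.
by rewrite -(cvg_shiftS (fun n => growth c n / n%:R `^ c)).
Qed.

End growth_factors.

(** * L1 distances of a submartingale, controlled by a potential *)

Section submartingale.
Context {R : realType}.
Implicit Types (x : nat -> R) (n : nat).

Lemma avg_tower n m (g : (nat -> R) -> R) : order_inv n g -> (n <= m)%N ->
  avg m g = avg n g.
Proof.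
move=> gI /subnKC <-; elim: (m - n)%N => [|k IH]; first by rewrite addn0.
rewrite addnS -IH (avg_step (H := fun x _ => g x)); last first.
  by move=> _; apply: order_inv_widen gI; exact: leq_addr.
apply: eq_avg => x _; rewrite sumr_const card_ord -[g x *+ _]mulr_natl.
by rewrite mulrA mulVf ?mul1r// pnatr_eq0.
Qed.

(** [D n] is the conditional drift of [Z] given the first [n] items; [drift] states this by testing
    against weights [G]. The decrements of one potential [s] pay for both the mean drift and the
    mean squared innovation, so that both sums telescope. *)
Variables (Z D : nat -> (nat -> R) -> R) (s : nat -> R).
Hypothesis ZI : forall n, order_inv n (Z n).
Hypothesis DI : forall n, order_inv n (D n).
Hypothesis drift : forall n (G : (nat -> R) -> R), (0 < n)%N -> order_inv n G ->
  avg n.+1 (fun x => G x * Z n.+1 x) = avg n (fun x => G x * (Z n x + D n x)).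
Hypothesis D_ge0 : forall n x, (0 < n)%N -> 0 <= D n x.
Hypothesis s_ge0 : forall n, 0 <= s n.
Hypothesis avg_drift_le : forall n, (0 < n)%N -> avg n (D n) <= s n - s n.+1.
Hypothesis avg_var_le : forall n, (0 < n)%N ->
  avg n.+1 (fun x => (Z n.+1 x - Z n x - D n x) ^+ 2) <= s n - s n.+1.

(** The martingale part of the Doob decomposition, restarted at time [n]. *)
Let U n m x := Z m x - Z n x - \sum_(n <= j < m) D j x.

Let UI n m : (n <= m)%N -> order_inv m (U n m).
Proof.
move=> nm x y xy; rewrite /U (ZI xy); congr (_ - _ - _).
  by apply: ZI => i j ip jp; apply: xy; exact: leq_trans nm.
rewrite !big_nat; apply: eq_bigr => k /andP[_ km].
by apply: DI => i j ip jp; apply: xy; apply: leq_trans (ltnW km).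
Qed.

Let avg_sqU n k : (0 < n)%N ->
  avg (n + k) (fun x => U n (n + k) x ^+ 2) <= s n - s (n + k).
Proof.
move=> n0; elim: k => [|k IH].
  rewrite addn0 subrr (@eq_avg _ _ _ (fun=> 0)) ?avg_cst// => x _.
  by rewrite /U big_geq// subrr subr0 expr0n.
rewrite addnS; set m := (n + k)%N in IH *.
have nm : (n <= m)%N by exact: leq_addr.
have m0 : (0 < m)%N by exact: leq_trans nm.
pose W x := Z m.+1 x - Z m x - D m x.
have -> : avg m.+1 (fun x => U n m.+1 x ^+ 2) =
    avg m (fun x => U n m x ^+ 2) +
    (2 * avg m.+1 (fun x => U n m x * W x) + avg m.+1 (fun x => W x ^+ 2)).
  rewrite -(@avg_tower m m.+1)//; last by move=> x y xy; rewrite (UI nm xy).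
  rewrite -avgZ -!avgD; apply: eq_avg => x _.
  rewrite {1}/U /W big_nat_recr//= /U.
  by ring.
(* Orthogonality: [U n m] is determined at time [m], hence is an admissible weight in [drift]. *)
have -> : avg m.+1 (fun x => U n m x * W x) = 0.
  transitivity (avg m.+1 (fun x => U n m x * Z m.+1 x) -
      avg m.+1 (fun x => U n m x * (Z m x + D m x))).
    by rewrite -avgB; apply: eq_avg => x _; rewrite /W; ring.
  rewrite drift//; last exact: UI.
  rewrite [X in _ - X](@avg_tower m)//; first by rewrite subrr.
  by move=> x y xy; rewrite (UI nm xy) (ZI xy) (DI xy).
have := avg_var_le m0; rewrite -/W; lra.
Qed.

Let avg_drift n k : (0 < n)%N ->
  avg (n + k) (fun x => \sum_(n <= j < n + k) D j x) <= s n - s (n + k).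
Proof.
move=> n0; elim: k => [|k IH].
  rewrite addn0 subrr (@eq_avg _ _ _ (fun=> 0)) ?avg_cst// => x _.
  by rewrite big_geq.
rewrite addnS; set m := (n + k)%N in IH *.
have nm : (n <= m)%N by exact: leq_addr.
have m0 : (0 < m)%N by exact: leq_trans nm.
rewrite (@avg_tower m)//; last first.
  move=> x y xy; rewrite !big_nat; apply: eq_bigr => i /andP[_]; rewrite ltnS => im.
  by apply: DI => a b ia ib; apply: xy; exact: leq_trans im.
rewrite (eq_avg (h := fun x => \sum_(n <= j < m) D j x + D m x)); last first.
  by move=> x _; rewrite big_nat_recr.
by rewrite avgD; have := avg_drift_le m0; lra.
Qed.

(* [|u| <= t + u^2 / t] trades the second moment for the first without
   Cauchy-Schwarz. *)
Lemma avg_dist_le n m (t : R) : (0 < n)%N -> (n <= m)%N -> 0 < t ->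
  avg m (fun x => `|Z m x - Z n x|) <= t + s n / t + s n.
Proof.
move=> n0 nm t0; rewrite -(subnKC nm); set k := (m - n)%N.
apply: (@le_trans _ _ (avg (n + k) (fun x => t + t^-1 * U n (n + k) x ^+ 2 +
    \sum_(n <= j < n + k) D j x))).
  apply: le_avg => x _; set d := \sum_(_ <= _ < _) _.
  have d0 : 0 <= d.
    rewrite /d big_nat_cond; apply: sumr_ge0 => j /andP[/andP[nj _] _].
    by rewrite D_ge0// (leq_trans n0).
  have -> : Z (n + k)%N x - Z n x = U n (n + k) x + d by rewrite /U subrK.
  move: (U _ _ _) => u; rewrite (le_trans (ler_normD _ _))// (ger0_norm d0).
  rewrite lerD2r -(ler_pM2l t0) mulrDr mulrA mulfV ?gt_eqF// mul1r.
  rewrite -(real_normK (num_real u)); have := normr_ge0 u.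
  by move: (`|u|) => v v0; nra.
rewrite !avgD avg_cst avgZ.
have Hs := avg_sqU k n0; have Hd := avg_drift k n0; have s0 := s_ge0 (n + k).
rewrite -addrA -[leRHS]addrA lerD2l; apply: lerD; last lra.
by rewrite mulrC ler_pM2r ?invr_gt0//; apply: le_trans Hs _; lra.
Qed.

End submartingale.

(** * Moments and L1 distances of the numbers retained and of the rank sums *)

Section percentile_estimates.
Context {R : realType}.
Variable p : R.
Hypotheses (p_gt0 : 0 < p) (p_lt_half : p < 2^-1).
Implicit Types (x : nat -> R) (n : nat).

Let L x n : R := (num_retained p x n)%:R.
Let Q x n : R := (rank_sum p x n)%:R.
Let k x n : R := (quota p x n)%:R.
Let a n : R := growth p n.
Let b n : R := growth (2 * p) n.

Let p_ge0 : 0 <= p. Proof. exact: ltW. Qed.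
Let p_le1 : p <= 1. Proof. by have := p_lt_half; lra. Qed.
Let pN1 : -1 <= p. Proof. by have := p_gt0; lra. Qed.
Let k_ge0 x n : 0 <= k x n. Proof. exact: ler0n. Qed.
Let L_ge0 x n : 0 <= L x n. Proof. exact: ler0n. Qed.
Let k_le x n : k x n <= p * (L x n + p^-1).
Proof. by rewrite mulrDr mulfV ?gt_eqF// quota_le. Qed.
Let k_ge x n : p * L x n <= k x n. Proof. exact: quota_ge. Qed.
Let k_leL x n : k x n <= L x n. Proof. by rewrite ler_nat quota_le_num. Qed.
Let k_ge1 x n : (0 < n)%N -> 1 <= k x n.
Proof. by move=> n0; rewrite ler1n quota_gt0. Qed.
Let k_len x n : k x n <= n.+1%:R.
Proof. by rewrite ler_nat ltnW// quota_ltn. Qed.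
Let a_gt0 n : 0 < a n. Proof. exact: growth_gt0. Qed.
Let b_gt0 n : 0 < b n.
Proof. by apply: growth_gt0; have := p_gt0; lra. Qed.

(** Under the hypothesis on [F], one step multiplies the mean by at most [1 + c/(n+1)]. It is
    applied with [c = p], [2p] and [-p]; the bound [-1 <= c] keeps this factor nonnegative, as the
    induction needs. *)
Lemma avg_num_retained_le (F : nat -> R) c n : -1 <= c ->
  (forall x n, (0 < n)%N -> (quota p x n)%:R *
    (F (num_retained p x n).+1 - F (num_retained p x n)) <=
    c * F (num_retained p x n)) ->
  (0 < n)%N -> avg n (fun x => F (num_retained p x n)) <= F 1%N * growth c n.
Proof.
move=> c1 Fc; case: n => // n _; elim: n => [|n IH].
  rewrite growth1 mulr1 (@eq_avg _ _ _ (fun=> F 1%N)) ?avg_cst//.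
  by move=> x _; rewrite num_retained1.
rewrite (avg_num_retained_step p_gt0 p_lt_half (F := fun _ => F))//.
apply: (@le_trans _ _ (avg n.+1
    (fun x => (1 + c / n.+2%:R) * F (num_retained p x n.+1)))).
  apply: le_avg => x _; rewrite mulrDl mul1r lerD2l.
  by rewrite !(mulrAC _ n.+2%:R^-1) ler_wpM2r ?invr_ge0// Fc.
have c0 : 0 <= 1 + c / n.+2%:R.
  rewrite -lerBlDl sub0r (@le_trans _ _ (- n.+2%:R^-1))//.
    by rewrite lerN2 invf_le1// ler1n.
  by rewrite -mulN1r ler_wpM2r// invr_ge0.
by rewrite avgZ growthS// mulrA [leRHS]mulrC ler_wpM2l.
Qed.

(** The shift absorbs the ceiling: [k <= p L + 1 = p (L + 1/p)], so the shifted mean grows at the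
    pure rate [p]. *)
Lemma avg_num_retained_moment1 n : (0 < n)%N ->
  avg n (fun x => L x n + p^-1) <= (1 + p^-1) * a n.
Proof.
apply: (@avg_num_retained_le (fun l => l%:R + p^-1)) => // x m _.
rewrite -natr1 -/(L x m).
have -> : L x m + 1 + p^-1 - (L x m + p^-1) = 1 by ring.
by rewrite mulr1 k_le.
Qed.

(** A rising factorial in [l = L + 1/p] replaces the square: [l (l+1)] has increment [2 (l+1)],
    which with [k <= p l] yields exactly the rate [2p]. *)
Lemma avg_num_retained_moment2 n : (0 < n)%N ->
  avg n (fun x => (L x n + p^-1) * (L x n + p^-1 + 1)) <=
  (1 + p^-1) * (2 + p^-1) * b n.
Proof.
move=> n0; have -> : 2 + p^-1 = 1%:R + p^-1 + 1 :> R by ring.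
apply: (@avg_num_retained_le (fun l => (l%:R + p^-1) * (l%:R + p^-1 + 1))) n0.
  by have := p_gt0; lra.
move=> x m _; rewrite -natr1 -/(L x m) -/(k x m).
set l := L x m + p^-1; have -> : L x m + 1 + p^-1 = l + 1 by rewrite /l; ring.
have l0 : 0 <= l by rewrite addr_ge0// invr_ge0.
have -> : (l + 1) * (l + 1 + 1) - l * (l + 1) = 2 * (l + 1) by ring.
rewrite mulrCA -mulrA ler_pM2l// mulrA ler_wpM2r//.
by rewrite addr_ge0.
Qed.

(* For [l >= 2], [1 / (l - 1)] decreases by [1 / (l * (l - 1))] when [l] grows
   by one, which happens with probability at least [p * l / n.+1]: its mean
   shrinks by the factor [1 - p / n.+1]. *)
Lemma avg_inv_num_retained_le n : (0 < n)%N ->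
  avg n (fun x => (L x n)^-1) <= 2 / a n.
Proof.
(* At [l = 1], where [1/(l-1)] makes no sense, the value 2 works: passing to [F 2 = 1] loses 1 with
   weight [k >= 1], and [2 p < 1]. *)
move=> n0; pose F (l : nat) : R := if (l <= 1)%N then 2 else l.-1%:R^-1.
apply: (@le_trans _ _ (avg n (fun x => F (num_retained p x n)))).
  apply: le_avg => x _; rewrite /F /L.
  have := num_retained_gt0 p_gt0 x n0.
  case: (num_retained p x n) => // -[|l] _ /=; first by rewrite invr1 ler1n.
  by rewrite lef_pV2 ?posrE ?ltr0n// ler_nat.
have H : avg n (fun x => F (num_retained p x n)) <= F 1%N * growth (- p) n.
  apply: avg_num_retained_le n0; first by rewrite lerN2.
  move=> x m m0; have := num_retained_gt0 p_gt0 x m0.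
  have := k_ge1 x m0; have := k_ge x m; rewrite /L /F -/(k x m).
  case: (num_retained p x m) => // -[|l] kl k1 _ /=.
    by have := p_lt_half; rewrite invr1; lra.
  rewrite -[l.+2%:R]natr1 in kl *.
  have l0 : 0 < l.+1%:R :> R by rewrite ltr0n.
  move: (l.+1%:R : R) (k x m) l0 kl k1 => u v u0 kl k1.
  have -> : v * ((u + 1)^-1 - u^-1) = - (v / (u + 1)) / u.
    by field; rewrite !gt_eqF ?ltr_wpDr.
  rewrite ler_wpM2r ?invr_ge0 ?(ltW u0)// lerN2 ler_pdivlMr// ltr_wpDr//.
rewrite (le_trans H)// /F /= ler_wpM2l//.
by apply: growthN_le; rewrite p_ge0.
Qed.

(** The ceiling exceeds [p L] by at most 1, which bounds the drift. The variance and the first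
    moment together give [p (1 + 1/p) = p + 1] over [(n+1) a_(n+1)], and [inv_growth_step] turns
    this into the decrement of [(p+1)/p / a_n]. *)
Lemma avg_num_retained_dist n m t : (0 < n)%N -> (n <= m)%N -> 0 < t ->
  avg m (fun x => `|L x m / a m - L x n / a n|) <=
  t + (p + 1) / p / a n / t + (p + 1) / p / a n.
Proof.
pose D n x := (k x n - p * L x n) / (n.+1%:R * a n.+1).
have Ps j : (0 < j)%N -> (p + 1) / p / a j - (p + 1) / p / a j.+1 =
    (p + 1) / (j.+1%:R * a j.+1).
  move=> j0; rewrite -mulrBr inv_growth_step// mulrA divfK ?gt_eqF//.
apply: (@avg_dist_le _ (fun n x => L x n / a n) D (fun n => (p + 1) / p / a n)).
- by move=> j x y xy; rewrite /L (num_retained_order_inv p xy).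
- move=> j x y xy.
  by rewrite /D /L /k (num_retained_order_inv p xy) (quota_order_inv p xy).
- move=> j G j0 GI.
  rewrite (avg_num_retained_step p_gt0 p_lt_half
    (F := fun x l => G x * (l%:R / a j.+1)))//; last first.
    by move=> l x y xy; rewrite (GI _ _ xy).
  apply: eq_avg => x _; rewrite /D /a growthS//.
  rewrite -[(num_retained p x j).+1%:R]natr1 -/(L x j) -/(k x j).
  have a0 : growth p j != 0 by rewrite gt_eqF.
  have N0 : (0 : R) < j.+1%:R by rewrite ltr0n.
  move: (j.+1%:R : R) (growth p j) N0 a0 => N u N0 u0.
  have -> : 1 + p / N = (N + p) / N by field; rewrite gt_eqF.
  have Np : N + p != 0 by rewrite gt_eqF// ltr_wpDr.
  by field; rewrite Np u0 gt_eqF.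
- by move=> j x _; rewrite divr_ge0 ?subr_ge0// mulr_ge0 ?ltW.
- by move=> j; rewrite divr_ge0 ?(ltW (a_gt0 _))// divr_ge0// addr_ge0.
- move=> j j0; rewrite Ps//; set v := _ / (_ * a _).
  rewrite -(avg_cst j v); apply: le_avg => x _.
  rewrite /D /v ler_wpM2r ?invr_ge0 ?mulr_ge0 ?(ltW (a_gt0 _))//.
  by have := k_le x j; rewrite mulrDr mulfV ?gt_eqF//; have := p_gt0; lra.
move=> j j0; rewrite Ps//.
rewrite (avg_num_retained_step p_gt0 p_lt_half
  (F := fun x l => (l%:R / a j.+1 - L x j / a j - D j x) ^+ 2))//; last first.
  move=> l x y xy.
  by rewrite /D /L /k (num_retained_order_inv p xy) (quota_order_inv p xy).
have N0 : (0 : R) < j.+1%:R by rewrite ltr0n.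
apply: (@le_trans _ _ (avg j (fun x => p / (j.+1%:R * a j.+1 ^+ 2) *
    (L x j + p^-1)))).
  apply: le_avg => x _.
  have E : L x j / a j + D j x = (L x j + k x j / j.+1%:R) / a j.+1.
    rewrite /D /a growthS//.
    have a0 : growth p j != 0 by rewrite gt_eqF.
    move: (j.+1%:R : R) (growth p j) N0 a0 => N u N0 u0.
    have -> : 1 + p / N = (N + p) / N by field; rewrite gt_eqF.
    have Np : N + p != 0 by rewrite gt_eqF// ltr_wpDr.
    by field; rewrite Np u0 gt_eqF.
  rewrite -!addrA -!opprD E -[(num_retained p x j).+1%:R]natr1.
  rewrite -/(L x j) -/(k x j) -!mulrBl.
  rewrite [_ / (_ * _) * _]mulrAC ler_pdivlMr ?mulr_gt0 ?exprn_gt0//.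
  (* The increment of [L] is a Bernoulli variable of parameter [k/(n+1)]; this is its variance times
     n+1. *)
  have -> : (((L x j - (L x j + k x j / j.+1%:R)) / a j.+1) ^+ 2 +
    k x j / j.+1%:R * (((L x j + 1 - (L x j + k x j / j.+1%:R)) / a j.+1) ^+ 2 -
    ((L x j - (L x j + k x j / j.+1%:R)) / a j.+1) ^+ 2)) *
    (j.+1%:R * a j.+1 ^+ 2) = k x j - k x j ^+ 2 / j.+1%:R.
    by field; rewrite !gt_eqF.
  by rewrite (le_trans _ (k_le x j))// lerBlDr lerDl divr_ge0// sqr_ge0.
rewrite avgZ; set c := p / _.
apply: (@le_trans _ _ (c * ((1 + p^-1) * a j.+1))).
  have c0 : 0 <= c by rewrite divr_ge0// mulr_ge0// sqr_ge0.
  apply: ler_wpM2l => //; apply: le_trans (avg_num_retained_moment1 j0) _.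
  by rewrite ler_wpM2l ?addr_ge0 ?invr_ge0// growth_homo.
rewrite le_eqVlt; apply/orP; left; apply/eqP; rewrite /c.
by have := a_gt0 j.+1 => a0; field; rewrite !gt_eqF.
Qed.

Lemma rank_sum_increment x n : (0 < n)%N -> untied n.+1 x ->
  0 <= Q x n.+1 - Q x n <= L x n + k x n.
Proof.
move=> n0 ux; rewrite /Q (rank_sumS p_gt0)// -addnA natrD addrAC subrr add0r.
rewrite ler0n -natrD ler_nat leq_add ?num_outranked_le//.
by case: (leqP (rank x n.+1 n)) => [rk|_]; rewrite ?mul1n.
Qed.

Lemma rank_sum_le x n : Q x n <= n%:R * L x n.
Proof.
rewrite /Q /L -natrM ler_nat /rank_sum /num_retained cardfE -sum1_card.
rewrite big_seq_fsetE /= big_distrr /=.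
by apply: leq_sum => i _; rewrite muln1 rank_le.
Qed.

(** In the constant, [(1 + 1/p) (2 + 1/p)] is the shifted second moment at time 1, [1 - 2p] comes
    from [growth_div_step], and 16 is a generous common factor for drift and variance. *)
Lemma avg_rank_sum_dist n m t : (0 < n)%N -> (n <= m)%N -> 0 < t ->
  let s := 16 * (1 + p^-1) * (2 + p^-1) / (1 - 2 * p) * (b n / n.+1%:R) in
  avg m (fun x => `|Q x m / m.+1%:R - Q x n / n.+1%:R|) <= t + s / t + s.
Proof.
move=> n0 nm t0 /=; set C := 16 * _ * _ / _.
have pp : 0 < 1 - 2 * p by have := p_lt_half; lra.
pose D n x := k x n * (k x n + 1) / (2 * (n.+1%:R * n.+2%:R)).
have C0 : 0 <= C.
  rewrite divr_ge0 ?(ltW pp)// mulr_ge0// ?mulr_ge0 ?addr_ge0 ?invr_ge0//.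
have Ps j : (0 < j)%N -> C * (b j / j.+1%:R) - C * (b j.+1 / j.+2%:R) =
    16 * ((1 + p^-1) * (2 + p^-1) * b j) / (j.+1%:R * j.+2%:R).
  move=> j0; rewrite -mulrBr growth_div_step// /C -/(b j).
  have : j.+1%:R != 0 :> R by rewrite pnatr_eq0.
  have : j.+2%:R != 0 :> R by rewrite pnatr_eq0.
  move: (j.+1%:R : R) (j.+2%:R : R) (b j) => u v w v0 u0.
  by field; rewrite u0 v0 !gt_eqF.
apply: (@avg_dist_le _ (fun n x => Q x n / n.+1%:R) D
  (fun n => C * (b n / n.+1%:R))) => //.
- by move=> j x y xy; rewrite /Q (rank_sum_order_inv p xy).
- by move=> j x y xy; rewrite /D /k (quota_order_inv p xy).
- move=> j G j0 GI.
  transitivity (avg j.+1 (fun x => (G x / j.+2%:R) * Q x j.+1)).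
    by apply: eq_avg => x _; rewrite mulrCA mulrC.
  rewrite (avg_rank_sum_step p_gt0 p_lt_half)//; last first.
    by move=> x y xy; rewrite (GI _ _ xy).
  apply: eq_avg => x _; rewrite /D -[(quota p x j).+1%:R]natr1 -/(k x j).
  have : j.+1%:R != 0 :> R by rewrite pnatr_eq0.
  have : j.+2%:R != 0 :> R by rewrite pnatr_eq0.
  move: (j.+1%:R : R) (j.+2%:R : R) => u v u0 v0; rewrite -/(Q x j).
  by field; rewrite u0 v0.
- by move=> j x _; rewrite divr_ge0// mulr_ge0// addr_ge0.
- by move=> j; rewrite mulr_ge0// divr_ge0// ltW.
- move=> j j0; rewrite Ps//.
  apply: (@le_trans _ _ (avg j (fun x => 16 / (j.+1%:R * j.+2%:R) *
      ((L x j + p^-1) * (L x j + p^-1 + 1))))).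
    apply: le_avg => x _; rewrite /D invfM mulrA [leRHS]mulrAC.
    rewrite ler_wpM2r ?invr_ge0//.
    have l0 : L x j <= L x j + p^-1 by rewrite lerDl invr_ge0.
    have := k_leL x j; have := k_ge0 x j; have := L_ge0 x j.
    move: (L x j) (k x j) (L x j + p^-1) l0 => u v w uw u0 v0 vu.
    have vw : v * (v + 1) <= w * (w + 1) by apply: ler_pM; lra.
    have : 0 <= v * (v + 1) by rewrite mulr_ge0// addr_ge0.
    lra.
  rewrite avgZ [leLHS]mulrAC ler_wpM2r ?invr_ge0// ler_pM2l//.
  exact: avg_num_retained_moment2.
move=> j j0; rewrite Ps//.
apply: (@le_trans _ _ (avg j.+1 (fun x => 16 / (j.+1%:R * j.+2%:R) *
    ((L x j + p^-1) * (L x j + p^-1 + 1))))).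
  apply: le_avg => x ux.
  have Q1 := rank_sum_increment j0 ux; have Q2 := rank_sum_le x j.
  have Q0 : 0 <= Q x j by exact: ler0n.
  have -> : Q x j.+1 / j.+2%:R - Q x j / j.+1%:R - D j x =
      ((Q x j.+1 - Q x j) -
       (Q x j / j.+1%:R + k x j * (k x j + 1) / (2 * j.+1%:R)))
      / j.+2%:R.
    rewrite /D -[j.+2%:R]natr1; have : 0 < j.+1%:R :> R by rewrite ltr0n.
    move: (j.+1%:R : R) => v v0; field.
    by rewrite !gt_eqF// ltr_wpDr.
  have q1 : Q x j / j.+1%:R <= L x j.
    rewrite ler_pdivrMr ?ltr0n// (le_trans Q2)// mulrC ler_wpM2l//.
    by rewrite ler_nat.
  have q0 : 0 <= Q x j / j.+1%:R by rewrite divr_ge0.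
  have d1 : k x j * (k x j + 1) / (2 * j.+1%:R) <= L x j.
    rewrite ler_pdivrMr ?mulr_gt0//; apply: ler_pM => //; first by rewrite addr_ge0.
    have := k_len x j; have : 1 <= j.+1%:R :> R by rewrite ler1n.
    lra.
  have d0 : 0 <= k x j * (k x j + 1) / (2 * j.+1%:R).
    by rewrite divr_ge0 ?mulr_ge0 ?addr_ge0.
  have := k_leL x j; have := L_ge0 x j; have := k_ge0 x j.
  move: (Q x j.+1 - Q x j) (Q x j / j.+1%:R) (k x j * _ / _) Q1 q1 q0 d1 d0.
  move=> A B E /andP[A0 A1] B1 B0 E1 E0 k0 l0 kl.
  have l1 : L x j <= L x j + p^-1 by rewrite lerDl invr_ge0.
  rewrite expr_div_n.
  (* The raw increment [A] and its compensator [B + E] both lie in [[0, 2L]], so their difference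
     has square at most [4 L^2]. *)
  apply: (@le_trans _ _ (16 * (L x j * (L x j + 1)) / (j.+1%:R * j.+2%:R))).
    apply: ler_pM; rewrite ?sqr_ge0 ?invr_ge0//.
      have : (A - (B + E)) ^+ 2 <= (2 * L x j) ^+ 2.
        rewrite -real_normK ?num_real// lerXn2r ?nnegrE ?mulr_ge0//.
        by rewrite ler_norml; apply/andP; split; lra.
      by have := sqr_ge0 (L x j); rewrite !expr2; nra.
    by rewrite lef_pV2 ?posrE ?exprn_gt0 ?mulr_gt0// -natrX -natrM ler_nat leq_mul.
  rewrite [leRHS]mulrAC ler_wpM2r ?invr_ge0// ler_pM2l//.
  by apply: ler_pM; lra.
rewrite avgZ (@avg_tower _ j)//; last first.
  by move=> x y xy; rewrite /L (num_retained_order_inv p xy).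
rewrite [leLHS]mulrAC ler_wpM2r ?invr_ge0// ler_pM2l//.
exact: avg_num_retained_moment2.
Qed.

End percentile_estimates.

(** * A weight separating the two processes *)

Section witness.
Context {R : realType}.
Variable p : R.
Hypotheses (p_gt0 : 0 < p) (p_lt_half : p < 2^-1).
Implicit Types (x : nat -> R) (n : nat).

(* Conditioned on the third item having relative rank 2 or 3, the process of
   the numbers of retained items has the same law, but the rank sum does
   not. *)
Definition contrast x : R := (rank x 3 2 == 2)%:R - (rank x 3 2 == 3)%:R.

Lemma contrast_order_inv n : (3 <= n)%N -> order_inv n contrast.
Proof.
move=> n3; apply: order_inv_widen n3 _ => x y xy.
by rewrite /contrast (rank_order_inv _ xy).
Qed.

Lemma contrast_le1 x : `|contrast x| <= 1.
Proof.
rewrite /contrast; case: eqP => [->|_]; first by rewrite subr0 normr1.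
by case: eqP; rewrite ?subr0 ?normr0// sub0r normrN normr1.
Qed.

Let avg_contrast_step (H : (nat -> R) -> nat -> R) :
  (forall a, order_inv 2 (H^~ a)) ->
  avg 3 (fun x => contrast x * H x (rank x 3 2)) =
  3%:R^-1 * avg 2 (fun x => H x 2 - H x 3).
Proof.
move=> HI; pose K x r := ((r == 2)%:R - (r == 3)%:R) * H x r.
rewrite [LHS](_ : _ = avg 3 (fun x => K x (rank x 3 2)))//.
rewrite avg_step => [|a x y xy]; last by rewrite /K (HI _ _ _ xy).
rewrite -avgZ; apply: eq_avg => x _; congr (_ * _).
rewrite !big_ord_recl big_ord0 /K /=.
by ring.
Qed.

(** As at most 2 items are retained and [p < 1/2], the third item is rejected whether its rank is 2
    or 3; hence the choice of these two ranks. *)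
Let quota2 x : quota p x 2 = 1%N.
Proof.
apply/eqP; rewrite eqn_leq quota_gt0// andbT -ltnS -(ltr_nat R).
apply: le_lt_trans (quota_le p_gt0 x 2) _.
have L2 : (num_retained p x 2)%:R <= 2 :> R by rewrite ler_nat num_retained_le.
have := p_lt_half; have := p_gt0.
by move: (_%:R) L2 => u u2 p0 p2; nra.
Qed.

(** At time 3 ranks 2 and 3 leave the same number retained. Each later step replaces [F] by another
    function [G] of that number alone, so the induction runs over all [F]. *)
Lemma avg_contrast_num_retained (F : nat -> R) n : (3 <= n)%N ->
  avg n (fun x => contrast x * F (num_retained p x n)) = 0.
Proof.
move=> /subnKC <-; elim: (n - 3)%N F => {n} [|n IH] F.
  rewrite addn0 (eq_avg (h := fun x => contrast x * (fun x r =>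
      F (num_retained p x 2 + (r <= quota p x 2))%N) x (rank x 3 2))); last first.
    by move=> x _; rewrite num_retainedS.
  rewrite (avg_contrast_step (H := fun x r =>
      F (num_retained p x 2 + (r <= quota p x 2))%N)); last first.
    move=> a x y xy.
    by rewrite (quota_order_inv p xy) (num_retained_order_inv p xy).
  rewrite (eq_avg (h := fun=> 0)) ?avg_cst ?mulr0// => x _.
  by rewrite quota2 subrr.
rewrite addnS (avg_num_retained_step p_gt0 p_lt_half
  (F := fun x l => contrast x * F l))//; last first.
  by move=> l x y xy; rewrite (contrast_order_inv _ xy).
pose G l := F l + `|Num.ceil (p * l%:R)|%:R / (3 + n).+1%:R * (F l.+1 - F l).
rewrite -[RHS](IH G); apply: eq_avg => x _.
by rewrite /G /quota; ring.
Qed.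

Let delta : R := avg 3 (fun x => contrast x * (rank_sum p x 3)%:R) / 4.

(** The drift of [Q / (n+1)] is a function of [L] only, so [contrast] annihilates it and the value
    at time 3 stays frozen. *)
Lemma avg_contrast_rank_sum n : (3 <= n)%N ->
  avg n (fun x => contrast x * ((rank_sum p x n)%:R / n.+1%:R)) = delta.
Proof.
move=> /subnKC <-; elim: (n - 3)%N => {n} [|n IH].
  rewrite addn0 /delta mulrC -avgZ; apply: eq_avg => x _; ring.
rewrite addnS -IH.
rewrite (eq_avg (h := fun x => (contrast x / (3 + n).+2%:R) *
    (rank_sum p x (3 + n).+1)%:R)); last first.
  by move=> x _; rewrite mulrA mulrAC.
rewrite (avg_rank_sum_step p_gt0 p_lt_half)//; last first.
  by move=> x y xy; rewrite (contrast_order_inv _ xy).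
pose F l : R := `|Num.ceil (p * l%:R)|%:R * `|Num.ceil (p * l%:R)|.+1%:R.
rewrite -[RHS]addr0 -(mulr0 (2 * (3 + n).+1%:R * (3 + n).+2%:R)^-1).
rewrite -(@avg_contrast_num_retained F (3 + n))// -avgZ -avgD.
apply: eq_avg => x _; rewrite /F -/(quota p x (3 + n)).
have : (3 + n).+1%:R != 0 :> R by rewrite pnatr_eq0.
have : (3 + n).+2%:R != 0 :> R by rewrite pnatr_eq0.
move: ((3 + n).+1%:R : R) ((3 + n).+2%:R : R) => u v v0 u0.
by field; rewrite u0 v0.
Qed.

Lemma contrast_rank_sum_gt0 : exists2 e : R, 0 < e & forall n, (3 <= n)%N ->
  avg n (fun x => contrast x * ((rank_sum p x n)%:R / n.+1%:R)) = e.
Proof.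
exists delta; last exact: avg_contrast_rank_sum.
rewrite divr_gt0//.
rewrite (eq_avg (h := fun x => contrast x * (fun x r => (rank_sum p x 2 +
    num_outranked p x 2 r + (r <= quota p x 2) * r)%N%:R) x (rank x 3 2)));
  last by move=> x ux; rewrite (rank_sumS p_gt0).
rewrite (avg_contrast_step (H := fun x r => (rank_sum p x 2 +
    num_outranked p x 2 r + (r <= quota p x 2) * r)%N%:R)); last first.
  move=> a x y xy; rewrite (quota_order_inv p xy).
  by rewrite (rank_sum_order_inv p xy) (num_outranked_order_inv p _ xy).
rewrite mulr_gt0//.
(* The third item being rejected, ranks 2 and 3 differ only in whether a retained item of rank 2 is
   pushed up. *)
rewrite (eq_avg (h := fun x => (num_outranked p x 2 2)%:R)); last first.
  move=> x _; rewrite quota2 !mul0n !addn0 !natrD.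
  have -> : num_outranked p x 2 3 = 0%N.
    rewrite /num_outranked big1_seq// => i _.
    by rewrite leqNgt ltnS rank_le.
  by rewrite addr0 addrC addKr.
(* The transposition puts the worse of two items first: item 0, always retained, then has rank 2. *)
rewrite /avg mulr_gt0 ?invr_gt0// (bigD1 (tperm ord0 ord_max))//=.
rewrite ltr_wpDr ?sumr_ge0// ltr0n /num_outranked.
set x := pattern _.
have x0 : x 0 = 1 by rewrite /x (patternE _ ord0) tpermL.
have x1 : x 1 = 0 by rewrite /x (patternE _ ord_max) tpermR.
have in0 : 0%N \in retained p x 2.
  rewrite (retainedS p_gt0)//; case: ifP => _; by rewrite /= !inE.
rewrite (big_fsetD1 0%N)//= /rank !big_ord_recr big_ord0 /= x0 x1.
by rewrite lexx ler01.
Qed.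

End witness.

(** * Order patterns of i.i.d. samples *)

Lemma le_rank {R : realType} (x : nat -> R) n (i j : 'I_n) :
  (x i <= x j) = (rank x n i <= rank x n j)%N.
Proof.
have [xij|xji] := leP (x i) (x j).
  apply/esym/leq_sum => a _.
  by case: (leP (x a) (x i)) => // /le_trans /(_ xij) ->.
apply/esym/negbTE; rewrite -ltnNge /rank (bigD1 i)//= [ltnRHS](bigD1 i)//=.
rewrite lexx leNgt xji add0n add1n ltnS; apply: leq_sum => a _.
by case: (leP (x a) (x j)) => // /le_trans /(_ (ltW xji)) ->.
Qed.

(** The permutation sends each item to its rank minus one, injectively since there are no ties. *)
Lemma untied_pattern {R : realType} (x : nat -> R) n : untied n x ->
  exists s : 'S_n, same_order n x (pattern s : nat -> R).
Proof.
move=> ux; have r0 (i : 'I_n) : (0 < rank x n i)%N.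
  by rewrite /rank (bigD1 i)//= lexx.
have rn (i : 'I_n) : ((rank x n i).-1 < n)%N by rewrite prednK// rank_le.
have r_inj : injective (fun i => Ordinal (rn i)).
  move=> i j [] /(congr1 succn); rewrite !prednK// => rij.
  apply/val_inj/ux; rewrite ?ltn_ord//.
  by apply/le_anti; rewrite !le_rank rij leqnn.
exists (perm r_inj) => i j ip jp.
rewrite (patternE _ (Ordinal ip)) (patternE _ (Ordinal jp)) !permE ler_nat /=.
have := r0 (Ordinal ip); have := r0 (Ordinal jp).
rewrite (le_rank x (Ordinal ip) (Ordinal jp)) /=.
by case: (rank x n i) => // a; case: (rank x n j).
Qed.

Section exchangeability.
Context d (T : measurableType d) {R : realType} (P : probability T R).
Variable X : nat -> {RV P >-> R}.
Hypothesis indepX : mutually_independent X.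
Hypothesis idX : identically_distributed X.
Hypothesis contX : forall i : nat, continuous_distribution (X i).

Let rectangles n : set (set ('I_n -> R)) :=
  [set A | exists2 B : 'I_n -> set R, (forall i, measurable (B i)) &
    A = [set x | forall i, B i (x i)]].

Let X_ n (s : 'S_n) : T -> ('I_n -> R) := fun w i => X (s i) w.

Let preimage_rectangle n (s : 'S_n) (B : 'I_n -> set R) :
  X_ s @^-1` [set x | forall i, B i (x i)] =
  \bigcap_(i in [set: 'I_n]) (X (s i) @^-1` B i).
Proof. by apply/seteqP; split => w /= wB i; [move=> _|]; exact: wB. Qed.

Let measurable_rectangle n (s : 'S_n) (B : 'I_n -> set R) :
  (forall i, measurable (B i)) ->
  measurable (X_ s @^-1` [set x | forall i, B i (x i)]).
Proof.
move=> mB; rewrite preimage_rectangle; apply: fin_bigcap_measurable => // i _.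
exact: measurable_funPTI.
Qed.

Let prob_rectangle n (s : 'S_n) (B : 'I_n -> set R) :
  (forall i, measurable (B i)) ->
  P (X_ s @^-1` [set x | forall i, B i (x i)]) =
  (\prod_(i < n) distribution P (X 0) (B i))%E.
Proof.
move=> mB; pose I := [fset i in iota 0 n]%fset.
(* Independence is indexed by items, the rectangle by positions: item [j] stands at position
   [s^-1 j]. *)
pose B' (j : nat) : set R := oapp (fun j : 'I_n => B (s^-1 j)%g) setT (insub j).
have B'E (j : 'I_n) : B' j = B (s^-1 j)%g by rewrite /B' valK.
have mB' j : measurable (B' j) by rewrite /B'; case: insub => //= j'; exact: mB.
have := indepX I mB'.
have -> : \bigcap_(i in [set` I]) (X i @^-1` B' i) =
    X_ s @^-1` [set x | forall i, B i (x i)].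
  apply/seteqP; split => w /= wB.
    move=> i; have := wB (s i); rewrite B'E permK; apply.
    by rewrite /= !inE mem_iota /=.
  move=> j /=; rewrite !inE mem_iota /= add0n => jn.
  have := wB (s^-1 (Ordinal jn))%g; rewrite /X_ permKV.
  by rewrite -(B'E (Ordinal jn)).
move=> ->; have -> : (\prod_(i <- I) P (X i @^-1` B' i) =
    \prod_(i <- iota 0 n) P (X i @^-1` B' i))%E.
  apply: perm_big; apply: uniq_perm; rewrite ?fset_uniq ?iota_uniq// => i.
  by rewrite !inE.
rewrite -[n in iota 0 n]subn0 -/(index_iota 0 n) big_mkord.
rewrite (reindex_inj (@perm_inj _ s)); apply: eq_bigr => i _ /=.
by rewrite B'E permK (idX 0 (s i)).
Qed.

(** A pi-lambda argument from rectangles, where independence and equal distribution give the same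
    law for every permuted sample. Measurability is carried along because complements and unions
    require it. *)
Let law_perm n (A : set ('I_n -> R)) : <<s @rectangles n >> A ->
  forall s : 'S_n, measurable (X_ s @^-1` A) /\
    P (X_ s @^-1` A) = P (X_ (1%g : 'S_n) @^-1` A).
Proof.
pose G := @rectangles n.
pose same (B : set ('I_n -> R)) := forall s : 'S_n,
  measurable (X_ s @^-1` B) /\ P (X_ s @^-1` B) = P (X_ (1%g : 'S_n) @^-1` B).
move: A.
apply: (@dynkin_induction _ (g_sigma_algebraType G) G same) => //.
- move=> _ _ [B mB ->] [C mC ->]; exists (fun i => B i `&` C i).
    by move=> i; exact: measurableI.
  by apply/seteqP; split => x /=; [move=> [xB xC] i; split|
    move=> xBC; split => i; have [] := xBC i].
- by move=> s; rewrite !preimage_setT; split.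
- move=> _ [B mB ->] s; split; first exact: measurable_rectangle.
  by rewrite !prob_rectangle.
- move=> A' _ IH s; have [mA PA] := IH s; have [mA1 _] := IH 1%g.
  have E t : X_ (t : 'S_n) @^-1` (~` A') = ~` (X_ t @^-1` A') by [].
  rewrite !E; split; first exact: measurableC.
  by rewrite (probability_setC _ mA) (probability_setC _ mA1) PA.
- move=> F _ tF IH s.
  have E t : X_ (t : 'S_n) @^-1` (\bigcup_k F k) = \bigcup_k (X_ t @^-1` F k).
    by rewrite preimage_bigcup.
  rewrite !E.
  have tF' t : trivIset setT (fun k => X_ (t : 'S_n) @^-1` F k).
    by move=> a b _ _ [w [wa wb]]; apply: tF => //; exists (X_ t w).
  have mF t k : measurable (X_ (t : 'S_n) @^-1` F k) by have [] := IH k t.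
  split; first exact: bigcupT_measurable.
  rewrite !measure_bigcup//; apply: eq_eseriesr => k _.
  by have [] := IH k s.
Qed.

Let ordered n : set ('I_n -> R) :=
  [set x | forall i j : 'I_n, (x i <= x j) = (i <= j)%N].

Let measurable_ordered n : <<s @rectangles n >> (@ordered n).
Proof.
pose G := @rectangles n.
have mc i : measurable_fun setT
    ((fun x : 'I_n -> R => x i) : g_sigma_algebraType G -> R).
  move=> _ B mB; rewrite setTI; apply: sub_sigma_algebra.
  exists (fun j => if j == i then B else setT).
    by move=> j; case: ifP.
  apply/seteqP; split => x /=; last by move=> /(_ i); rewrite eqxx.
  by move=> xB j; case: eqP => [->|].
have -> : @ordered n = \bigcap_(ij in [set: 'I_n * 'I_n])
    [set x | (x ij.1 <= x ij.2) = (ij.1 <= ij.2)%N].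
  apply/seteqP; split => x /= xo; first by move=> [i j] _; exact: xo.
  by move=> i j; exact: (xo (i, j) I).
change (measurable (\bigcap_(ij in [set: 'I_n * 'I_n])
    [set x | (x ij.1 <= x ij.2) = (ij.1 <= ij.2)%N] :
    set (g_sigma_algebraType G))).
apply: fin_bigcap_measurable => // -[i j] _ /=.
have := @measurable_fun_ler _ _ _ _ _ _ (mc i) (mc j).
by move=> /(_ measurableT [set (i <= j)%N]); rewrite setTI; apply.
Qed.

Definition pattern_event n (s : 'S_n) : set T :=
  [set w | same_order n (fun i => X i w) (pattern s : nat -> R)].

(** The sample has pattern [s] when listing its items along [s^-1] sorts it. All pattern events are
    thus preimages of one set under permuted samples, hence equally likely. *)
Let pattern_eventE n (s : 'S_n) :
  pattern_event s = X_ (s^-1)%g @^-1` (@ordered n).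
Proof.
apply/seteqP; split => w /= wo.
  move=> i j; rewrite /X_ wo// !patternE !permKV ler_nat//.
move=> i j ip jp.
have := wo (s (Ordinal ip)) (s (Ordinal jp)); rewrite /X_ !permK /= => ->.
by rewrite (patternE s (Ordinal ip)) (patternE s (Ordinal jp)) ler_nat.
Qed.

Lemma measurable_pattern_event n (s : 'S_n) : measurable (pattern_event s).
Proof.
by rewrite pattern_eventE; have [] := law_perm (@measurable_ordered n) (s^-1)%g.
Qed.

Let prob_pattern_event n (s : 'S_n) :
  P (pattern_event s) = P (pattern_event (1%g : 'S_n)).
Proof.
rewrite !pattern_eventE.
have [_ ->] := law_perm (@measurable_ordered n) (s^-1)%g.
by have [_ ->] := law_perm (@measurable_ordered n) (1^-1)%g.
Qed.

Let pattern_inj n (s t : 'S_n) w :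
  pattern_event s w -> pattern_event t w -> s = t.
Proof.
move=> ws wt; apply/permP.
have st i j : (s i <= s j)%N = (t i <= t j)%N.
  by have := ws i j; rewrite wt// !patternE !ler_nat => <-.
have sE (u : 'S_n) (i : 'I_n) : (\sum_(j < n) (u j <= u i)%N)%N = (u i).+1.
  rewrite -[RHS](@sum_ltn_ord n)// [RHS](reindex_inj (@perm_inj _ u)).
  exact: eq_bigr.
move=> i; apply/val_inj/succn_inj; rewrite -!sE.
by apply: eq_bigr => j _; rewrite st.
Qed.

(** The mass strictly below [r] dominates the cdf at [r - 1/(n+1)], hence in the limit the cdf at
    [r]; nothing remains for the atom. *)
Lemma prob_singleton i (r : R) : distribution P (X i) [set r] = 0%E.
Proof.
pose u n : R := r - n.+1%:R^-1.
have u_cvg : u n @[n --> \oo] --> r.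
  rewrite -[X in _ --> X]subr0; apply: cvgB; first exact: cvg_cst.
  exact: cvg_harmonic.
have F_cvg : cdf (X i) (u n) @[n --> \oo] --> cdf (X i) r.
  by apply: continuous_cvg => //; exact: contX.
have rE : distribution P (X i) `]-oo, r] =
    (distribution P (X i) `]-oo, r[ + distribution P (X i) [set r])%E.
  rewrite -measureU//; last first.
    by apply/seteqP; split => // y /= [] /[swap] ->; rewrite in_itv/= ltxx.
  by rewrite setUitv1.
have le_cdf : (cdf (X i) r <= distribution P (X i) `]-oo, r[)%E.
  apply: (cvge_le _ F_cvg).
  apply: nearW => n; rewrite le_measure ?inE//.
  move=> y; rewrite /= !in_itv/= => /le_lt_trans; apply.
  by rewrite /u ltrBlDr ltrDl invr_gt0.
move: le_cdf; rewrite /cdf rE.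
have := fineK (fin_num_measure (distribution P (X i)) _ (measurable_itv `]-oo, r[)).
have := fineK (fin_num_measure (distribution P (X i)) _ (measurable_set1 r)).
have := measure_ge0 (distribution P (X i)) [set r].
move: (fine _) (fine _) => m v + mE vE; rewrite -!mE -!vE -EFinD !lee_fin => m0 vm.
by congr (_%:E); lra.
Qed.

Let pairX i j (w : T) : R * R := (X i w, X j w).

Let measurable_pairX i j : measurable_fun setT (pairX i j).
Proof. by apply: measurable_fun_pair; exact: measurable_funPT. Qed.

Let measurable_diagonal : measurable [set z : R * R | z.1 = z.2].
Proof.
have := @measurable_fun_eqr _ (R * R)%type R setT fst snd.
move=> /(_ measurable_fst measurable_snd measurableT [set true]).
rewrite setTI => H.
rewrite (_ : mkset _ = (fun z : R * R => z.1 == z.2) @^-1` [set true]).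
  exact: H.
by apply/seteqP; split => z /= /eqP.
Qed.

(** Fubini: the joint law is a product by independence, and the sections of the diagonal are null
    singletons. *)
Lemma prob_tie i j : i != j -> P [set w | X i w = X j w] = 0%E.
Proof.
move=> ij.
have H A B : measurable A -> measurable B -> pushforward P (pairX i j) (A `*` B) =
    (distribution P (X i) A * distribution P (X j) B)%E.
  move=> mA mB.
  have := indepX [fset i; j]%fset (B := fun k => if k == i then A else B).
  have -> : (\prod_(k <- [fset i; j]%fset)
      P (X k @^-1` (if k == i then A else B)) =
    distribution P (X i) A * distribution P (X j) B)%E.
    rewrite big_fsetU1/= ?inE// big_seq_fset1 eqxx.
    by rewrite eq_sym (negbTE ij).
  move=> <-; last by move=> k; case: ifP.
  congr (P _); apply/seteqP; split => w /=.
    move=> [wA wB] k; rewrite /= !inE => /orP[/eqP ->|/eqP ->].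
      by rewrite eqxx.
    by rewrite eq_sym (negbTE ij).
  move=> wAB; split; first by have := wAB i; rewrite /= !inE eqxx; exact.
  have := wAB j; rewrite /= !inE eqxx orbT => /(_ isT).
  by rewrite eq_sym (negbTE ij).
apply: etrans (esym (product_measure_unique H measurable_diagonal)) _.
  exact: measurable_pairX.
apply: integral0_eq => x _ /=.
rewrite -(prob_singleton j x); congr (distribution _ _ _).
by apply/seteqP; split => y; rewrite /xsection /= inE /=.
Qed.

Lemma ae_untied : {ae P, forall w, forall n, untied n (fun i => X i w)}.
Proof.
have H : {ae P, forall w, forall i j, i != j -> X i w <> X j w}.
  apply/ae_foralln => i; apply/ae_foralln => j.
  have [<-|ij] := eqVneq i j; first exact: aeW.
  exists [set w | X i w = X j w]; split.
  - have := @measurable_pairX i j measurableT _ measurable_diagonal.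
    by rewrite setTI; apply.
  - exact: prob_tie.
  - by move=> w /= /existsNP[_ /contrapT].
apply: filterS H => w wij n i j _ _ xij; apply/eqP.
by have [//|/wij] := eqVneq i j.
Qed.

(** The value is determined by the finite table [c] of comparisons. Unlike the pattern events, these
    tables also cover samples with ties, so measurability holds everywhere. *)
Lemma measurable_order_inv n (g : (nat -> R) -> R) :
  order_inv n g -> measurable_fun setT (fun w => g (fun i => X i w)).
Proof.
move=> gI _ B mB; rewrite setTI.
pose c (w : T) : {ffun 'I_n * 'I_n -> bool} := 
  [ffun ij : 'I_n * 'I_n => X ij.1 w <= X ij.2 w].
have -> : (fun w => g (fun i => X i w)) @^-1` B =
    \bigcup_(v in [set v | exists2 w, c w = v & B (g (fun i => X i w))])
      (c @^-1` [set v]).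
  apply/seteqP; split => [w Bw|w [_ [w' <- Bw']] /= cw].
    by exists (c w) => //; exists w.
  rewrite (gI _ (fun i => X i w'))// => i j ip jp.
  by move: cw => /ffunP/(_ (Ordinal ip, Ordinal jp)); rewrite !ffunE.
apply: fin_bigcup_measurable; first exact: finite_finset.
move=> v _.
have -> : c @^-1` [set v] = \bigcap_(ij in [set: 'I_n * 'I_n])
    [set w | (X ij.1 w <= X ij.2 w) = v ij].
  apply/seteqP; split => w /=; first by move=> <- ij _ /=; rewrite ffunE.
  by move=> cv; apply/ffunP => ij; rewrite ffunE; exact: cv.
apply: fin_bigcap_measurable; first exact: finite_finset.
move=> [i j] _ /=.
have mX k : measurable_fun setT (X k) by exact: measurable_funPT.
have := @measurable_fun_ler _ _ _ _ _ _ (mX i) (mX j).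
by move=> /(_ measurableT [set v (i, j)]); rewrite setTI; apply.
Qed.

Let integral_patterns n (g : (nat -> R) -> R) :
  order_inv n g -> (forall x, 0 <= g x) ->
  (\int[P]_w (g (fun i => X i w))%:E =
   \sum_(s : 'S_n) (g (pattern s))%:E * P (pattern_event s))%E.
Proof.
move=> gI g0.
transitivity (\int[P]_w
    (\sum_(s : 'S_n) (g (pattern s) * \1_(pattern_event s) w)%:E))%E.
  apply: ae_eq_integral => //.
  - by apply/measurable_EFinP; exact: measurable_order_inv gI.
  - apply: emeasurable_sum => s; apply/measurable_EFinP.
    apply: measurable_funM => //.
    exact/measurable_indic/measurable_pattern_event.
  apply: filterS ae_untied => w /(_ n)/untied_pattern[s ws] _.
  rewrite (bigD1 s)//= indicE mem_set// mulr1 big1 ?adde0 => [|t ts].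
    by rewrite (gI _ _ ws).
  rewrite indicE memNset ?mulr0//= => wt; move/eqP: ts; apply.
  exact: (pattern_inj (w := w)).
rewrite ge0_integral_sum//; last 2 first.
  - move=> s; apply/measurable_EFinP.
    apply: measurable_funM => //.
    exact/measurable_indic/measurable_pattern_event.
  - by move=> s w _; rewrite lee_fin mulr_ge0.
apply: eq_bigr => s _.
under eq_integral do rewrite EFinM.
rewrite ge0_integralZl_EFin//; last first.
  exact/measurable_EFinP/measurable_indic/measurable_pattern_event.
by rewrite integral_indic ?setIT//; exact: measurable_pattern_event.
Qed.

Lemma prob_pattern n (s : 'S_n) : P (pattern_event s) = (n`!%:R^-1)%:E.
Proof.
have I1 : order_inv n (fun _ : nat -> R => 1 : R) by [].
have := integral_patterns I1 (fun=> ler01).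
rewrite integral_cst// [X in (_ * X)%E](@probability_setT _ _ _ P) mule1.
under eq_bigr do rewrite mul1e prob_pattern_event.
rewrite prob_pattern_event.
rewrite -(fineK (fin_num_measure P _ (measurable_pattern_event (1%g : 'S_n)))).
move: (fine _) => q; rewrite sumEFin sumr_const card_Sn => -[] q1.
by congr (_%:E); apply: (mulIf (x := n`!%:R));
  rewrite ?mulVf ?mulr_natr// pnatr_eq0 -lt0n fact_gt0.
Qed.

(** Only nonnegative integrands cross this bridge; signed means, such as those against [contrast],
    are handled on the finite side. *)
Lemma integral_order_inv n (g : (nat -> R) -> R) :
  order_inv n g -> (forall x, 0 <= g x) ->
  (\int[P]_w (g (fun i => X i w))%:E = (avg n g)%:E)%E.
Proof.
move=> gI g0; rewrite (integral_patterns gI g0).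
under eq_bigr do rewrite prob_pattern -EFinM.
by rewrite sumEFin -mulr_suml mulrC.
Qed.

End exchangeability.

(** * Almost sure convergence *)

Section interpolation.
Context {R : realType}.

Lemma cvg_ratioS : (k.+2%:R / k.+1%:R : R) @[k --> \oo] --> (1 : R).
Proof.
have -> : (fun k => k.+2%:R / k.+1%:R : R) = (fun k => 1 + k.+1%:R^-1).
  by apply/funext => k; rewrite -natr1 mulrDl mulfV ?pnatr_eq0// mul1r.
rewrite -[X in _ --> X]addr0; apply: cvgD; first exact: cvg_cst.
exact: cvg_harmonic.
Qed.

Lemma cvg_ratioX m : ((k.+2 ^ m)%:R / (k.+1 ^ m)%:R : R) @[k --> \oo] --> (1 : R).
Proof.
have -> : (fun k => (k.+2 ^ m)%:R / (k.+1 ^ m)%:R : R) =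
    (fun k => (k.+2%:R / k.+1%:R) ^+ m).
  by apply/funext => k; rewrite !natrX expr_div_n.
elim: m => [|m IH]; first by under eq_fun do rewrite expr0; exact: cvg_cst.
have -> : (fun k => (k.+2%:R / k.+1%:R : R) ^+ m.+1) =
    (fun k => k.+2%:R / k.+1%:R) \* (fun k => (k.+2%:R / k.+1%:R) ^+ m).
  by apply/funext => k; rewrite exprS.
by rewrite -[X in _ --> X]mulr1; apply: cvgM IH; exact: cvg_ratioS.
Qed.

(* A monotone sequence is controlled between consecutive terms of a
   subsequence whose successive ratios tend to 1. *)
Lemma cvg_powR_interpolation (c l : R) m (u : nat -> R) :
  0 <= c <= 1 -> (0 < m)%N -> nondecreasing_seq u -> (forall n, 0 <= u n) ->
  u (k.+1 ^ m)%N / (k.+1 ^ m)%:R `^ c @[k --> \oo] --> l ->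
  u n / n%:R `^ c @[n --> \oo] --> l.
Proof.
move=> c01 m0 u_nd u0 ul; have /andP[c0 c1] := c01.
pose v k := u (k.+1 ^ m)%N / (k.+1 ^ m)%:R `^ c.
pose r k : R := (k.+2 ^ m)%:R / (k.+1 ^ m)%:R.
have r1 k : 1 <= r k.
  by rewrite ler_pdivlMr ?ltr0n ?expn_gt0// mul1r ler_nat leq_exp2r.
(* The alternative [k == 0] covers [n = 0], which lies below every power. *)
have exk n : exists k, (k == 0%N) || (k.+1 ^ m <= n)%N by exists 0%N.
have bk n k : (k == 0%N) || (k.+1 ^ m <= n)%N -> (k <= n)%N.
  move=> /orP[/eqP ->//|]; apply: leq_trans.
  by rewrite ltnW// -[X in (_ < X)%N]expn1 (leq_trans _ (leq_pexp2l _ m0))// expn1.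
have r_gt0 k : 0 < r k by exact: lt_le_trans (r1 k).
pose K n := ex_maxn (exk n) (bk n).
have Kle n : (0 < n)%N -> ((K n).+1 ^ m <= n)%N.
  by move=> n0; rewrite /K; case: ex_maxnP => k /orP[/eqP ->|]//; rewrite exp1n.
have ltK n : (n < (K n).+2 ^ m)%N.
  rewrite /K; case: ex_maxnP => k _ kmax; rewrite ltnNge; apply/negP => H.
  by have := kmax k.+1 H; rewrite ltnn.
have Koo : K n @[n --> \oo] --> \oo.
  apply/cvgnyPge => A; exists (A.+1 ^ m)%N => // n /= An.
  by rewrite /K; case: ex_maxnP => k _; apply; rewrite An orbT.
(* A ratio that is at least 1 only shrinks when raised to a power [c <= 1], so plain ratios suffice
   as bounds. *)
have ratio_pow a b : (0 < a)%N -> (a <= b)%N ->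
    b%:R `^ c <= a%:R `^ c * (b%:R / a%:R) :> R.
  move=> a0 ab; have a0' : 0 < a%:R :> R by rewrite ltr0n.
  rewrite -[b%:R in leLHS](divfK (lt0r_neq0 a0')) powRM ?divr_ge0// mulrC.
  rewrite ler_wpM2l ?powR_ge0// -[leRHS]powRr1 ?divr_ge0//.
  by rewrite ler_powR// ler_pdivlMr// mul1r ler_nat.
have low n : (0 < n)%N -> v (K n) / r (K n) <= u n / n%:R `^ c.
  move=> n0; have e0 : (0 < (K n).+1 ^ m)%N by rewrite expn_gt0.
  rewrite /v -mulrA -invfM; apply: ler_pM => //.
  - by rewrite invr_ge0 mulr_ge0 ?powR_ge0// (le_trans ler01).
  - by apply: u_nd; exact: Kle.
  rewrite lef_pV2 ?posrE ?powR_gt0 ?ltr0n//; last first.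
    by rewrite mulr_gt0// powR_gt0// ltr0n.
  apply: le_trans (ratio_pow _ _ e0 (Kle _ n0)) _.
  by rewrite ler_wpM2l ?powR_ge0// ler_wpM2r ?invr_ge0// ler_nat ltnW.
have high n : (0 < n)%N -> u n / n%:R `^ c <= v (K n).+1 * r (K n).
  move=> n0; have e0 : (0 < (K n).+1 ^ m)%N by rewrite expn_gt0.
  have e1 : (0 < (K n).+2 ^ m)%N by rewrite expn_gt0.
  rewrite /v -mulrA; apply: ler_pM; rewrite ?invr_ge0 ?powR_ge0//.
    by apply: u_nd; exact/ltnW.
  rewrite ler_pdivlMl ?powR_gt0 ?ltr0n// ler_pdivrMr ?powR_gt0 ?ltr0n//.
  rewrite mulrC.
  apply: le_trans (ratio_pow _ _ n0 (ltnW (ltK n))) _.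
  rewrite ler_wpM2l ?powR_ge0// ler_wpM2l// lef_pV2 ?posrE ?ltr0n//.
  by rewrite ler_nat Kle.
have low_cvg : v (K n) / r (K n) @[n --> \oo] --> l.
  apply: (cvg_comp K (fun k => v k / r k) Koo).
  have : v k / r k @[k --> \oo] --> l / 1.
    by apply: cvgM => //; apply: cvgV; [exact: oner_neq0|exact: cvg_ratioX].
  by rewrite divr1.
have high_cvg : v (K n).+1 * r (K n) @[n --> \oo] --> l.
  apply: (cvg_comp K (fun k => v k.+1 * r k) Koo).
  have : v k.+1 * r k @[k --> \oo] --> l * 1.
    by apply: cvgM; [rewrite (cvg_shiftS v)|exact: cvg_ratioX].
  by rewrite mulr1.
apply: squeeze_cvgr low_cvg high_cvg.
by exists 1%N => // n /= n0; rewrite low// high.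
Qed.

Lemma sum_inv_sqr_le n : \sum_(k < n) (k.+1%:R ^+ 2)^-1 <= 2 :> R.
Proof.
suff H : \sum_(k < n.+1) (k.+1%:R ^+ 2)^-1 <= 2 - n.+1%:R^-1 :> R.
  apply: (@le_trans _ _ (\sum_(k < n.+1) (k.+1%:R ^+ 2)^-1)).
    by rewrite big_ord_recr /= lerDl invr_ge0 sqr_ge0.
  by rewrite (le_trans H)// gerBl invr_ge0.
elim: n => [|n IH]; first by rewrite big_ord1 expr1n !invr1; lra.
rewrite big_ord_recr /=; have := IH.
have : 0 < n.+1%:R :> R by rewrite ltr0n.
rewrite -[n.+2%:R]natr1; move: (n.+1%:R : R) => N N0 {}IH.
suff : ((N + 1) ^+ 2)^-1 <= N^-1 - (N + 1)^-1 by move: IH; lra.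
have N1 : 0 < N + 1 by rewrite addr_gt0.
have -> : N^-1 - (N + 1)^-1 = (N * (N + 1))^-1.
  by field; rewrite !gt_eqF.
by rewrite lef_pV2 ?posrE ?mulr_gt0 ?exprn_gt0// expr2 ler_wpM2r ?ltW// ltrDl.
Qed.

End interpolation.

(** * From L1 bounds to almost sure statements *)

Section L1_convergence.
Context d (T : measurableType d) {R : realType} (P : probability T R).

(** The sum of the absolute increments has integral at most [C], so it is almost surely finite and
    the telescoping series converges absolutely. *)
Lemma ae_cvg_summable_increments (f : nat -> T -> R) (c : nat -> R) (C : R) :
  (forall k, measurable_fun setT (f k)) ->
  (forall k, \int[P]_w `|f k.+1 w - f k w|%:E <= (c k)%:E)%E ->
  (forall n, \sum_(k < n) c k <= C) ->
  {ae P, forall w, cvgn (f^~ w)}.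
Proof.
move=> mf fc cC; pose D k w : \bar R := `|f k.+1 w - f k w|%:E.
have D0 k w : (0 <= D k w)%E by rewrite lee_fin.
have mD k : measurable_fun setT (D k).
  apply/measurable_EFinP; apply: measurableT_comp => //.
  exact: measurable_funB.
have S0 w : (0 <= \sum_(k <oo) D k w)%E by exact: nneseries_ge0.
have intS : P.-integrable setT (fun w => \sum_(k <oo) D k w)%E.
  apply/integrableP; split; first by apply: ge0_emeasurable_sum => // k w _ _.
  under eq_integral do rewrite gee0_abs//.
  rewrite integral_nneseries//.
  apply: (@le_lt_trans _ _ C%:E); last by rewrite ltry.
  apply: lime_le.
    by apply: is_cvg_nneseries => k _ _; exact: integral_ge0.
  apply: nearW => n; rewrite big_mkord; apply: (@le_trans _ _ (\sum_(k < n) (c k)%:E)%E).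
    by apply: lee_sum => k _; exact: fc.
  by rewrite sumEFin lee_fin.
have := integrable_ae measurableT intS; apply: filterS => w /(_ I) Sfin.
have : cvgn (series (telescope (f^~ w))).
  apply: normed_cvg; apply: nondecreasing_is_cvgn.
    by apply: nondecreasing_series => k _ _; exact: normr_ge0.
  exists (fine (\sum_(k <oo) D k w)) => _ [n _ <-].
  rewrite -lee_fin fineK// /series/= -sumEFin.
  exact: nneseries_lim_ge.
rewrite telescopeK => H.
have -> : f^~ w = (fun n => f n w - f 0%N w) \+ cst (f 0%N w).
  by apply/funext => n /=; rewrite subrK.
by apply: is_cvgD => //; exact: is_cvg_cst.
Qed.

Let limn_einf_le (u : nat -> \bar R) (c : \bar R) :
  (forall n, u n <= c)%E -> (limn_einf u <= c)%E.
Proof.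
move=> uc; rewrite limn_einf_lim; apply: lime_le; first exact: is_cvg_einfs.
apply: nearW => n; apply: le_trans (uc n).
by apply: ereal_inf_lbound; exists n => /=.
Qed.

Let measurable_limn_einf (f : nat -> T -> \bar R) :
  (forall k, measurable_fun setT (f k)) ->
  measurable_fun setT (fun w => limn_einf (f^~ w)).
Proof.
move=> mf; apply: measurableT_comp => //; apply: measurable_fun_limn_esup => k.
exact: measurableT_comp.
Qed.

(** By Fatou the lower limit is integrable, hence almost surely finite. Applied to [a_n / L_n], it
    excludes a zero limit of [L_n / a_n]. *)
Lemma ae_not_cvg_pinfty (f : nat -> T -> R) (C : R) :
  (forall k, measurable_fun setT (f k)) -> (forall k w, 0 <= f k w) ->
  (forall k, \int[P]_w (f k w)%:E <= C%:E)%E ->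
  {ae P, forall w, ~ (f k w @[k --> \oo] --> +oo)}.
Proof.
move=> mf f0 fC; pose g w := limn_einf (fun k => (f k w)%:E).
have mf' k : measurable_fun setT (fun w => (f k w)%:E) by exact/measurable_EFinP.
have g0 w : (0 <= g w)%E.
  rewrite /g limn_einf_lim; apply: lime_ge; first exact: is_cvg_einfs.
  apply: nearW => n; apply: le_ereal_inf_tmp => _ [k _ <-].
  by rewrite lee_fin.
have intg : P.-integrable setT g.
  apply/integrableP; split; first exact: measurable_limn_einf.
  under eq_integral do rewrite gee0_abs//.
  apply: (@le_lt_trans _ _ C%:E); last by rewrite ltry.
  apply: le_trans (fatou _ _ _ _) _ => //; first by move=> k w _; rewrite lee_fin.
  exact: limn_einf_le.
have := integrable_ae measurableT intg; apply: filterS => w /(_ I) gfin.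
move=> /cvgeryP/cvg_limn_einf_sup[gE _].
by move: gfin; rewrite /g gE.
Qed.

(** Fatou as [j] tends to infinity turns an L1 Cauchy bound into a bound on the distance to the
    almost sure limit. *)
Lemma L1_dist_lim0 (f : nat -> T -> R) k (t : R) :
  (forall k, measurable_fun setT (f k)) ->
  {ae P, forall w, f k w @[k --> \oo] --> 0} ->
  (forall j, (k <= j)%N -> \int[P]_w `|f j w - f k w|%:E <= t%:E)%E ->
  (\int[P]_w `|f k w|%:E <= t%:E)%E.
Proof.
move=> mf f0 ft; pose h j w : \bar R := `|f (j + k)%N w - f k w|%:E.
have mh j : measurable_fun setT (h j).
  apply/measurable_EFinP; apply: measurableT_comp => //.
  exact: measurable_funB.
have h0 j w : (0 <= h j w)%E by rewrite lee_fin.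
apply: (@le_trans _ _ (\int[P]_w limn_einf (h^~ w))%E).
  apply: ae_ge0_le_integral => //.
  - by apply/measurable_EFinP; exact: measurableT_comp.
  - move=> w _; rewrite limn_einf_lim; apply: lime_ge; first exact: is_cvg_einfs.
    by apply: nearW => n; apply: le_ereal_inf_tmp => _ [j _ <-].
  - exact: measurable_limn_einf.
  apply: filterS f0 => w fw _.
  suff /cvg_limn_einf_sup[-> _] : h j w @[j --> \oo] --> `|f k w|%:E by [].
  apply/fine_cvgP; split; first exact: nearW.
  rewrite -[f k w]opprK normrN -[- f k w]add0r; apply: cvg_norm.
  by apply: cvgB; [rewrite (cvg_shiftn k (fun j => f j w))|exact: cvg_cst].
apply: le_trans (fatou _ _ _ _) _ => //.
by apply: limn_einf_le => j; apply: ft; exact: leq_addl.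
Qed.

End L1_convergence.

(** * Choice of the subsequence and passage to the whole sequence *)

Section subsequence.
Context {R : realType}.
Variable p : R.
Hypotheses (p_gt0 : 0 < p) (p_lt_half : p < 2^-1).

Let p_ge0 : 0 <= p. Proof. exact: ltW. Qed.
Let p01 : 0 <= p <= 1. Proof. by have := p_lt_half; have := p_gt0; lra. Qed.
Let p2_01 : 0 <= 2 * p <= 1.
Proof. by have := p_lt_half; have := p_gt0; lra. Qed.

Lemma growth_le_powR (c : R) n : 0 <= c <= 1 -> (0 < n)%N ->
  growth c n <= n%:R `^ c.
Proof.
move=> c01; case: n => // n _.
suff : growth c n.+1 / n.+1%:R `^ c <= 1.
  by rewrite ler_pdivrMr ?mul1r// powR_gt0.
elim: n => [|n]; first by rewrite growth1 powR1 invr1 mulr1.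
by apply: le_trans; exact: growth_powR_nonincreasing.
Qed.

(** The exponent 4 is twice the summable exponent 2, because [avg_dist_le] costs a square root of
    [s]. *)
Let expn_powR (c : R) m k : 4 <= m%:R * c ->
  ((k.+1 ^ m)%:R `^ c)^-1 <= (k.+1%:R ^+ 4)^-1.
Proof.
move=> mc; have k1 : 1 <= k.+1%:R :> R by rewrite ler1n.
have k0 : 0 < k.+1%:R :> R by rewrite ltr0n.
rewrite lef_pV2 ?posrE ?exprn_gt0 ?powR_gt0 ?ltr0n ?expn_gt0//.
by rewrite natrX -!powR_mulrn// -powRrM ler_powR.
Qed.

Lemma inv_growth_subseq m k : 4 <= m%:R * p ->
  (growth p (k.+1 ^ m))^-1 <= 2 * (k.+1%:R ^+ 4)^-1.
Proof.
move=> mp; apply: le_trans (ler_wpM2l _ (expn_powR k mp)); last by [].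
have e0 : (0 < k.+1 ^ m)%N by rewrite expn_gt0.
have g0 : 0 < growth p (k.+1 ^ m).
  by rewrite growth_gt0//; have := p_gt0; lra.
have P0 : 0 < (k.+1 ^ m)%:R `^ p :> R by rewrite powR_gt0// ltr0n.
rewrite -[leLHS]mul1r ler_pdivrMr// mulrAC ler_pdivlMr// mul1r.
apply: (@le_trans _ _ (((k.+1 ^ m)%N.+1)%:R `^ p)).
  by rewrite ge0_ler_powR// ?nnegrE// ler_nat.
apply: le_trans (growth_ge_powR p01 e0) _.
rewrite mulrC ler_wpM2r ?(ltW g0)// -[leRHS]powRr1// ler_powR//.
  by rewrite ler1n.
by have /andP[] := p01.
Qed.

Lemma growth2_subseq m k : 4 <= m%:R * (1 - 2 * p) ->
  growth (2 * p) (k.+1 ^ m) / (k.+1 ^ m).+1%:R <= (k.+1%:R ^+ 4)^-1.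
Proof.
move=> mp; apply: le_trans _ (expn_powR k mp).
have e0 : (0 < k.+1 ^ m)%N by rewrite expn_gt0.
move: (k.+1 ^ m)%N e0 => e e0; have e0' : 0 < e%:R :> R by rewrite ltr0n.
rewrite powRB ?(gt_eqF e0') ?implybT// powRr1// invfM invrK.
rewrite [leRHS]mulrC; apply: ler_pM => //.
- by rewrite ltW// growth_gt0//; have := p_gt0; lra.
- exact: growth_le_powR.
- by rewrite lef_pV2 ?posrE ?ltr0n// ler_nat.
Qed.

(** The choice is [t = (k+1)^-2]: as [s <= C t^2] and [t <= 1], both [s / t] and [s] are at most
    [C t], whence [1 + 2 C]. *)
Lemma subseq_dist (Z : nat -> (nat -> R) -> R) (s : nat -> R) (C : R) m j k :
  (forall n n' t, (0 < n)%N -> (n <= n')%N -> 0 < t ->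
    avg n' (fun x => `|Z n' x - Z n x|) <= t + s n / t + s n) ->
  0 <= C -> s (k.+1 ^ m)%N <= C * (k.+1%:R ^+ 4)^-1 -> (k <= j)%N ->
  avg (j.+1 ^ m) (fun x => `|Z (j.+1 ^ m)%N x - Z (k.+1 ^ m)%N x|) <=
  (1 + 2 * C) * (k.+1%:R ^+ 2)^-1.
Proof.
move=> HZ C0 sC kj; set u := k.+1%:R : R in sC *.
have u1 : 1 <= u by rewrite ler1n.
have u0 : 0 < u by exact: lt_le_trans u1.
have U0 : 0 < (u ^+ 2)^-1 by rewrite invr_gt0 exprn_gt0.
have ek : (0 < k.+1 ^ m)%N by rewrite expn_gt0.
have ekj : (k.+1 ^ m <= j.+1 ^ m)%N by case: (m) => // m'; rewrite leq_exp2r.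
apply: le_trans (HZ _ _ _ ek ekj U0) _.
have -> : (1 + 2 * C) * (u ^+ 2)^-1 =
    (u ^+ 2)^-1 + C * (u ^+ 2)^-1 + C * (u ^+ 2)^-1 by ring.
have UU : (u ^+ 4)^-1 = (u ^+ 2)^-1 * (u ^+ 2)^-1 by rewrite -invfM -exprD.
have U1 : (u ^+ 2)^-1 <= 1 by rewrite invf_le1 ?exprn_gt0// exprn_ege1.
rewrite UU in sC; apply: lerD; first apply: lerD => //.
  by rewrite ler_pdivrMr// -mulrA.
apply: le_trans sC _; rewrite mulrA ler_piMr// mulr_ge0// ltW//.
Qed.

Lemma subseq_exists : exists m, [/\ (0 < m)%N, 4 <= m%:R * p &
  4 <= m%:R * (1 - 2 * p)].
Proof.
have p2 : 0 < 1 - 2 * p by have := p_lt_half; lra.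
pose m1 := (Num.truncn (4 / p)).+1; pose m2 := (Num.truncn (4 / (1 - 2 * p))).+1.
have H1 : 4 / p <= m1%:R by rewrite ltW// real_truncnS_gt// num_real.
have H2 : 4 / (1 - 2 * p) <= m2%:R by rewrite ltW// real_truncnS_gt// num_real.
exists (m1 + m2)%N; split=> //.
  by rewrite -ler_pdivrMr// (le_trans H1)// ler_nat leq_addr.
by rewrite -ler_pdivrMr// (le_trans H2)// ler_nat leq_addl.
Qed.

Lemma L1_subsequence : exists m (C : R), [/\ (0 < m)%N, 0 <= C,
  forall j k, (k <= j)%N -> avg (j.+1 ^ m) (fun x =>
    `|(num_retained p x (j.+1 ^ m))%:R / growth p (j.+1 ^ m) -
      (num_retained p x (k.+1 ^ m))%:R / growth p (k.+1 ^ m)|) <=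
    C * (k.+1%:R ^+ 2)^-1 &
  forall j k, (k <= j)%N -> avg (j.+1 ^ m) (fun x =>
    `|(rank_sum p x (j.+1 ^ m))%:R / (j.+1 ^ m).+1%:R -
      (rank_sum p x (k.+1 ^ m))%:R / (k.+1 ^ m).+1%:R|) <=
    C * (k.+1%:R ^+ 2)^-1].
Proof.
have [m [m0 mp mp2]] := subseq_exists.
have p2 : 0 < 1 - 2 * p by have := p_lt_half; lra.
pose C1 : R := (p + 1) / p * 2.
pose C2 : R := 16 * (1 + p^-1) * (2 + p^-1) / (1 - 2 * p).
have C10 : 0 <= C1 by rewrite mulr_ge0// divr_ge0// addr_ge0.
have V0 : 0 <= p^-1 by rewrite invr_ge0.
have C20 : 0 <= C2.
  by rewrite divr_ge0 ?(ltW p2)// !mulr_ge0// addr_ge0.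
exists m, ((1 + 2 * C1) + (1 + 2 * C2)); split => //.
- by rewrite !addr_ge0// mulr_ge0.
- move=> j k kj; rewrite mulrDl ler_wpDr//.
    by rewrite mulr_ge0 ?invr_ge0 ?sqr_ge0// addr_ge0// mulr_ge0.
  apply: (subseq_dist (Z := fun n x => (num_retained p x n)%:R / growth p n)
    (s := fun n => (p + 1) / p / growth p n)) => //.
    by move=> n n' t; exact: avg_num_retained_dist.
  by rewrite -[leRHS]mulrA ler_wpM2l ?inv_growth_subseq// divr_ge0// addr_ge0.
move=> j k kj; rewrite mulrDl ler_wpDl//.
  by rewrite mulr_ge0 ?invr_ge0 ?sqr_ge0// addr_ge0// mulr_ge0.
apply: (subseq_dist (Z := fun n x => (rank_sum p x n)%:R / n.+1%:R)
  (s := fun n => C2 * (growth (2 * p) n / n.+1%:R))) => //.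
  by move=> n n' t; exact: avg_rank_sum_dist.
by rewrite ler_wpM2l// growth2_subseq.
Qed.

(** The ratio is [Q_n / n] divided by [L_n / n^p]. Both [Q] and [L] are nondecreasing (for [Q],
    through the absence of ties), so each is interpolated separately, with exponents 1 and [p]. *)
Lemma avg_rank_cvg (x : nat -> R) m (kappa lambda q : R) : (0 < m)%N ->
  (forall n, untied n x) -> 0 < kappa -> 0 < lambda ->
  growth p n / n%:R `^ p @[n --> \oo] --> kappa ->
  (num_retained p x (k.+1 ^ m))%:R / growth p (k.+1 ^ m)
    @[k --> \oo] --> lambda ->
  (rank_sum p x (k.+1 ^ m))%:R / (k.+1 ^ m).+1%:R @[k --> \oo] --> q ->
  avg_rank p x n / n%:R `^ (1 - p) @[n --> \oo] --> q / (lambda * kappa).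
Proof.
move=> m0 ux k0 l0 gk Ll Qq.
have eoo : (k.+1 ^ m)%N @[k --> \oo] --> \oo.
  apply/cvgnyPge => A; exists A => // k /= Ak.
  rewrite (leq_trans Ak)// (leq_trans (leqnSn k))// -[X in (X <= _)%N]expn1.
  by rewrite leq_pexp2l.
have L_cvg : (num_retained p x n)%:R / n%:R `^ p @[n --> \oo] --> lambda * kappa.
  apply: (cvg_powR_interpolation (u := fun n => (num_retained p x n)%:R) p01 m0).
  - apply/nondecreasing_seqP => n; rewrite ler_nat.
    have [->|n0] := posnP n; first by rewrite leq0n.
    by rewrite (num_retainedS p_gt0)// leq_addr.
  - by move=> n; exact: ler0n.
  have -> : (fun k => (num_retained p x (k.+1 ^ m))%:R / (k.+1 ^ m)%:R `^ p) =
      (fun k => (num_retained p x (k.+1 ^ m))%:R / growth p (k.+1 ^ m)) \*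
      (fun k => growth p (k.+1 ^ m) / (k.+1 ^ m)%:R `^ p).
    apply/funext => k /=; rewrite mulrA divfK// gt_eqF// growth_gt0//.
    by have := p_gt0; lra.
  apply: cvgM => //.
  exact: (cvg_comp (fun k => k.+1 ^ m)%N
    (fun n => growth p n / n%:R `^ p) eoo).
have Q_cvg : (rank_sum p x n)%:R / n%:R `^ 1 @[n --> \oo] --> q.
  apply: (cvg_powR_interpolation (u := fun n => (rank_sum p x n)%:R) _ m0).
  - by rewrite ler01 lexx.
  - apply/nondecreasing_seqP => n.
    have [->|n0] := posnP n; first by rewrite /rank_sum big_seq_fset0 ler0n.
    by have /andP[] := rank_sum_increment p_gt0 n0 (ux n.+1);
      rewrite subr_ge0.
  - by move=> n; exact: ler0n.
  (* The hypothesis divides by [e + 1], interpolation by [e]; the correction [1 + 1/e] tends to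
     1. *)
  have -> : (fun k => (rank_sum p x (k.+1 ^ m))%:R / (k.+1 ^ m)%:R `^ 1 : R) =
      (fun k => (rank_sum p x (k.+1 ^ m))%:R / (k.+1 ^ m).+1%:R : R) \*
      (fun k => 1 + (k.+1 ^ m)%:R^-1).
    apply/funext => k /=; rewrite powRr1//.
    have e0 : 0 < (k.+1 ^ m)%:R :> R by rewrite ltr0n expn_gt0.
    rewrite -[(k.+1 ^ m).+1%:R]natr1; move: (_%:R) e0 => e e0.
    by field; rewrite !gt_eqF ?addr_gt0.
  rewrite -[X in _ --> X]mulr1; apply: cvgM => //.
  rewrite -[X in _ --> X]addr0; apply: cvgD; first exact: cvg_cst.
  apply: (cvg_comp (fun k => k.+1 ^ m)%N (fun n => n%:R^-1 : R) eoo).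
  rewrite -(cvg_shiftS (fun n => n%:R^-1 : R)); exact: cvg_harmonic.
have lk0 : lambda * kappa != 0 by rewrite gt_eqF// mulr_gt0.
apply: cvg_trans (cvgM Q_cvg (cvgV lk0 L_cvg)).
apply: near_eq_cvg; exists 1%N => // n /= n0.
rewrite /avg_rank invfM invrK powRB ?pnatr_eq0 -?lt0n ?n0 ?implybT//.
have L0 : (num_retained p x n)%:R != 0 :> R.
  by rewrite pnatr_eq0 -lt0n (num_retained_gt0 p_gt0).
have a0 : 0 < n%:R `^ p :> R by rewrite powR_gt0// ltr0n.
have b0 : 0 < n%:R `^ 1 :> R by rewrite powR_gt0// ltr0n.
by field; rewrite L0 !gt_eqF.
Qed.

End subsequence.

(** * Almost sure convergence and nondegeneracy of the limit *)

Section almost_sure_limits.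
Context d (T : measurableType d) {R : realType} (P : probability T R).
Variable X : nat -> {RV P >-> R}.
Hypothesis indepX : mutually_independent X.
Hypothesis idX : identically_distributed X.
Hypothesis contX : forall i : nat, continuous_distribution (X i).
Variable p : R.
Hypotheses (p_gt0 : 0 < p) (p_lt_half : p < 2^-1).

Let norm_num n (x : nat -> R) : R := (num_retained p x n)%:R / growth p n.
Let norm_sum n (x : nat -> R) : R := (rank_sum p x n)%:R / n.+1%:R.
Let sample w : nat -> R := fun i => X i w.

Let norm_numI n : order_inv n (norm_num n).
Proof. by move=> x y xy; rewrite /norm_num (num_retained_order_inv p xy). Qed.

Let norm_sumI n : order_inv n (norm_sum n).
Proof. by move=> x y xy; rewrite /norm_sum (rank_sum_order_inv p xy). Qed.

Let growth_p_gt0 n : 0 < growth p n.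
Proof. by rewrite growth_gt0//; have := p_gt0; lra. Qed.

Let integral_dist (Z : nat -> (nat -> R) -> R) n n' :
  (forall n, order_inv n (Z n)) -> (n <= n')%N ->
  (\int[P]_w `|Z n' (sample w) - Z n (sample w)|%:E =
   (avg n' (fun x => `|Z n' x - Z n x|))%:E)%E.
Proof.
move=> ZI nn'.
rewrite (integral_order_inv indepX idX contX (n := n')
  (g := fun x => `|Z n' x - Z n x|))// => x y xy.
by rewrite (ZI _ _ _ xy) (order_inv_widen nn' (ZI n) xy).
Qed.

Let ae_cvg_subseq (Z : nat -> (nat -> R) -> R) (C : R) m :
  (forall n, order_inv n (Z n)) -> 0 <= C ->
  (forall j k, (k <= j)%N ->
    avg (j.+1 ^ m) (fun x => `|Z (j.+1 ^ m)%N x - Z (k.+1 ^ m)%N x|) <=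
    C * (k.+1%:R ^+ 2)^-1) ->
  {ae P, forall w, cvgn (fun k => Z (k.+1 ^ m)%N (sample w))}.
Proof.
move=> ZI C0 ZC.
apply: (ae_cvg_summable_increments (f := fun k w => Z (k.+1 ^ m)%N (sample w))
  (c := fun k => C * (k.+1%:R ^+ 2)^-1) (C := C * 2)).
- by move=> k; exact: (measurable_order_inv X (ZI _)).
- move=> k; rewrite integral_dist ?lee_fin ?ZC//.
  by case: (m) => // m'; rewrite leq_exp2r.
- by move=> n; rewrite -mulr_sumr ler_wpM2l// sum_inv_sqr_le.
Qed.

Let ae_inv_norm_num m : {ae P, forall w,
  ~ ((norm_num (k.+1 ^ m) (sample w))^-1 @[k --> \oo] --> +oo)}.
Proof.
apply: (ae_not_cvg_pinfty (f := fun k w => (norm_num (k.+1 ^ m) (sample w))^-1)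
  (C := 2)).
- move=> k; apply: (measurable_order_inv X (n := (k.+1 ^ m)%N)
    (g := fun x => (norm_num (k.+1 ^ m) x)^-1)) => x y xy.
  by rewrite (norm_numI xy).
- by move=> k w; rewrite invr_ge0 divr_ge0// ltW.
move=> k; have ek : (0 < k.+1 ^ m)%N by rewrite expn_gt0.
rewrite (integral_order_inv indepX idX contX (n := (k.+1 ^ m)%N)
  (g := fun x => (norm_num (k.+1 ^ m) x)^-1)); last 2 first.
- by move=> x y xy; rewrite (norm_numI xy).
- by move=> x; rewrite invr_ge0 divr_ge0// ltW.
rewrite lee_fin (eq_avg (h := fun x => growth p (k.+1 ^ m) *
    (num_retained p x (k.+1 ^ m))%:R^-1)); last first.
  by move=> x _; rewrite /norm_num invfM invrK mulrC.
rewrite avgZ -ler_pdivlMl// mulrC.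
exact: avg_inv_num_retained_le.
Qed.

(** The L1 bounds are exported with the limits because nondegeneracy needs both along the same
    subsequence. *)
Lemma ae_avg_rank_cvg : exists m (C kappa : R), [/\ 0 < kappa, (0 < m)%N,
  forall j k, (k <= j)%N -> avg (j.+1 ^ m) (fun x =>
    `|norm_num (j.+1 ^ m) x - norm_num (k.+1 ^ m) x|) <=
    C * (k.+1%:R ^+ 2)^-1,
  forall j k, (k <= j)%N -> avg (j.+1 ^ m) (fun x =>
    `|norm_sum (j.+1 ^ m) x - norm_sum (k.+1 ^ m) x|) <=
    C * (k.+1%:R ^+ 2)^-1 &
  {ae P, forall w, exists lambda q : R, [/\ 0 < lambda,
    norm_num (k.+1 ^ m) (sample w) @[k --> \oo] --> lambda,
    norm_sum (k.+1 ^ m) (sample w) @[k --> \oo] --> q &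
    avg_rank p (sample w) n / n%:R `^ (1 - p) @[n --> \oo] -->
      q / (lambda * kappa)]}].
Proof.
have [m [C [m0 C0 numC sumC]]] := L1_subsequence p_gt0 p_lt_half.
have p01 : 0 <= p <= 1 by have := p_gt0; have := p_lt_half; lra.
have [kappa kappa0 gk] := growth_powR_cvg p01.
exists m, C, kappa; split => //.
have num_cvg := ae_cvg_subseq norm_numI C0 numC.
have sum_cvg := ae_cvg_subseq norm_sumI C0 sumC.
have untiedX := ae_untied indepX contX.
apply: filterS3 (filterI num_cvg sum_cvg) (ae_inv_norm_num m) untiedX.
move=> w [] /cvg_ex[lambda numl] /cvg_ex[q sumq] ninv ux.
have num_gt0 k : 0 < norm_num (k.+1 ^ m) (sample w).
  by rewrite divr_gt0// ltr0n (num_retained_gt0 p_gt0)// expn_gt0.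
have lambda_gt0 : 0 < lambda.
  rewrite lt_neqAle; apply/andP; split; last first.
    rewrite -(cvg_lim (@Rhausdorff R) numl); apply: limr_ge.
      by apply/cvg_ex; exists lambda.
    by apply: nearW => k; exact: ltW.
  (* A zero limit of these positive numbers would send their inverses to infinity. *)
  apply/eqP => l0; apply: ninv; apply/cvgrVy; first exact: nearW.
  by rewrite -l0 in numl.
exists lambda, q; split => //.
exact: (avg_rank_cvg p_gt0 p_lt_half m0).
Qed.

(* If q / (lambda * kappa) were a constant c, then norm_sum - c * kappa *
   norm_num would tend to 0 in L1 along the subsequence, although its
   integral against contrast is a positive constant. *)
Lemma avg_rank_limit_nondegenerate (Y : T -> R) :
  {ae P, forall w, avg_rank p (sample w) n / n%:R `^ (1 - p)
    @[n --> \oo] --> Y w} ->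
  ~ exists c, {ae P, forall w, Y w = c}.
Proof.
move=> Ycvg [c Yc].
have [m [C [kappa [kappa0 m0 numC sumC lims]]]] := ae_avg_rank_cvg.
pose Z n x := norm_sum n x - c * kappa * norm_num n x.
have ZI n : order_inv n (Z n).
  by move=> x y xy; rewrite /Z (norm_numI xy) (norm_sumI xy).
pose D : R := (1 + `|c * kappa|) * C.
have ZD j k : (k <= j)%N -> avg (j.+1 ^ m) (fun x =>
    `|Z (j.+1 ^ m)%N x - Z (k.+1 ^ m)%N x|) <= D * (k.+1%:R ^+ 2)^-1.
  move=> kj; have := numC _ _ kj; have := sumC _ _ kj.
  set e := (j.+1 ^ m)%N; set e' := (k.+1 ^ m)%N => sumC' numC'.
  apply: (@le_trans _ _ (avg e (fun x => `|norm_sum e x - norm_sum e' x| +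
      `|c * kappa| * `|norm_num e x - norm_num e' x|))).
    apply: le_avg => x _; rewrite -normrM.
    have -> : Z e x - Z e' x = (norm_sum e x - norm_sum e' x) -
        c * kappa * (norm_num e x - norm_num e' x) by rewrite /Z; ring.
    exact: ler_normB.
  rewrite avgD avgZ /D -mulrA mulrDl mul1r lerD// ler_wpM2l//.
have Z0 : {ae P, forall w,
    Z (k.+1 ^ m)%N (sample w) @[k --> \oo] --> (0 : R)}.
  apply: filterS3 Ycvg Yc lims => w Yw Ywc [lambda [q [l0 numl sumq avgq]]].
  have Yq : Y w = q / (lambda * kappa) by apply: cvg_unique Yw avgq.
  have -> : (0 : R) = q - c * kappa * lambda.
    by rewrite -Ywc Yq; field; rewrite !gt_eqF.
  apply: cvgB => //; apply: cvgM => //; exact: cvg_cst.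
have [e e0 eE] := contrast_rank_sum_gt0 p_gt0 p_lt_half.
have eD k : (2 <= k)%N -> e <= D * (k.+1%:R ^+ 2)^-1.
  move=> k2; have k3 : (3 <= k.+1 ^ m)%N.
    by rewrite (@leq_trans k.+1)// -[X in (X <= _)%N]expn1 leq_pexp2l.
  have : (\int[P]_w `|Z (k.+1 ^ m)%N (sample w)|%:E <=
      (D * (k.+1%:R ^+ 2)^-1)%:E)%E.
    apply: (L1_dist_lim0 (f := fun k w => Z (k.+1 ^ m)%N (sample w))) => //.
      by move=> j; exact: (measurable_order_inv X (ZI _)).
    move=> j kj; rewrite integral_dist ?lee_fin ?ZD//.
    by case: (m) => // m'; rewrite leq_exp2r.
  rewrite (integral_order_inv indepX idX contX (n := (k.+1 ^ m)%N)
    (g := fun x => `|Z (k.+1 ^ m)%N x|))//; last first.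
    by move=> x y xy; rewrite (ZI _ _ _ xy).
  rewrite lee_fin; apply: le_trans.
  (* [contrast] annihilates the [norm_num] part of [Z] and is bounded by 1: [e] is the mean of
     [contrast * Z], hence at most that of the absolute value of [Z]. *)
  rewrite -(eE _ k3) -[leLHS]subr0 -(mulr0 (c * kappa)).
  rewrite -(avg_contrast_num_retained p_gt0 p_lt_half
    (fun l => l%:R / growth p (k.+1 ^ m)) k3) -avgZ -avgB.
  apply: le_avg => x _.
  have -> : contrast x * ((rank_sum p x (k.+1 ^ m))%:R / (k.+1 ^ m).+1%:R) -
      c * kappa * (contrast x *
        ((num_retained p x (k.+1 ^ m))%:R / growth p (k.+1 ^ m))) =
      contrast x * Z (k.+1 ^ m)%N x by rewrite /Z /norm_sum /norm_num; ring.
  rewrite (le_trans (ler_norm _))// normrM -[leRHS]mul1r ler_wpM2r//.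
  exact: contrast_le1.
(* Large enough for [D / e < k+1 <= (k+1)^2], and at least 2 so that [eD] applies. *)
pose k := (Num.truncn (D / e)).+2.
have kD : D / e < k.+1%:R.
  apply: lt_trans (real_truncnS_gt (num_real _)) _.
  by rewrite ltr_nat /k ltnS leqnSn.
have : e <= D * (k.+1%:R ^+ 2)^-1 by apply: eD.
have k1 : 1 <= k.+1%:R :> R by rewrite ler1n.
have k0 : 0 < k.+1%:R :> R by rewrite ltr0n.
apply/negP; rewrite -ltNge ltr_pdivrMr ?exprn_gt0//.
rewrite -ltr_pdivrMl// mulrC (lt_le_trans kD)//.
by rewrite expr2 ler_peMr// ltW.
Qed.

End almost_sure_limits.

Theorem theorem5p2 (R : realType) (d : measure_display) (T : measurableType d)
    (P : probability T R) (X : nat -> {RV P >-> R}) (p : R)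
    (indepX : mutually_independent X)
    (idX : identically_distributed X)
    (contX : forall i : nat, continuous_distribution (X i))
    (p_gt0 : 0 < p) (p_lt_half : p < 2^-1) :
  exists Y : {RV P >-> R},
    {ae P, forall w : T,
      (fun n : nat => avg_rank p (fun i => X i w) n / n%:R `^ (1 - p))
        @ \oo --> Y w} /\
    nondegenerate_rv Y.
Proof.
have [m [C [kappa [_ _ _ _ lims]]]] :=
  ae_avg_rank_cvg indepX idX contX p_gt0 p_lt_half.
pose f n w := avg_rank p (fun i => X i w) n / n%:R `^ (1 - p).
(* The upper limit is measurable on the whole space and equals the limit wherever the latter
   exists. *)
pose Yf w : R := fine (limn_esup (fun n => (f n w)%:E)).
have mY : measurable_fun setT Yf.
  apply: measurableT_comp; first exact: fine_measurable.
  apply: measurable_fun_limn_esup => n; apply/measurable_EFinP.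
  apply: (measurable_order_inv X (g := fun x => avg_rank p x n / n%:R `^ (1 - p))
    (n := n)) => x y xy.
  by rewrite /avg_rank (num_retained_order_inv p xy) (rank_sum_order_inv p xy).
pose Y : {RV P >-> R} := mfun_Sub (mem_set mY).
have Ycvg : {ae P, forall w, f n w @[n --> \oo] --> Y w}.
  apply: filterS lims => w [lambda [q [_ _ _ fq]]].
  suff -> : Y w = q / (lambda * kappa) by [].
  have /cvg_limn_einf_sup[_ E] :
      (f n w)%:E @[n --> \oo] --> (q / (lambda * kappa))%:E.
    by apply/cvg_EFin => //; exact: nearW.
  by rewrite /= /Yf E.
exists Y; split => //.
exact: (avg_rank_limit_nondegenerate indepX idX contX p_gt0 p_lt_half Ycvg).
Qed.
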